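(* Let $0<a\le1/2$ and let $f\in S^*_{cs}$, i.e. $f\in\mathscr{A}$ with $$\frac{zf'(z)}{f(z)}\prec1+\frac{z}{(1-z)(1+az)}.$$ Then $$\|P_f\|\le\frac{2(2+a)}{1+a}.$$ The estimate is sharp, i.e. for each such $a$ the constant cannot be replaced by a smaller one valid for all $f\in S^*_{cs}$.
   Context: $\mathbb{D}=\{z\in\mathbb{C}:|z|<1\}$. $\mathscr{A}$ is the class of analytic functions $f$ on $\mathbb{D}$ with $f(0)=0$, $f'(0)=1$. For analytic $g,h$ on $\mathbb{D}$, $g\prec h$ (subordination) means $g=h\circ\omega$ for some analytic $\omega:\mathbb{D}\to\mathbb{D}$ with $\omega(0)=0$. For $f\in\mathscr{A}$ with $f'\ne0$ in $\mathbb{D}$, $P_f(z)=f''(z)/f'(z)$ and $\|P_f\|=\sup_{z\in\mathbb{D}}(1-|z|^2)|P_f(z)|$. *)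

(* Defs.v *)
From Stdlib Require Import Reals.
From Coquelicot Require Import Coquelicot.

Open Scope R_scope.

Definition unit_disc (z : C) : Prop := Cmod z < 1.

Definition analytic_at (f : C -> C) (z0 : C) : Prop :=
  exists (c : nat -> C) (r : posreal),
    forall z : C, Cmod (z - z0) < r ->
      @is_pseries C_AbsRing C_NormedModule c (z - z0)%C (f z).

Definition analytic_on (U : C -> Prop) (f : C -> C) : Prop :=
  forall z : C, U z -> analytic_at f z.

(* Functions on the disc are total functions on [C] whose values outside the
   disc are irrelevant: the disc is open, so [C_derive] and [analytic_at] at a
   point of it only depend on the values inside. *)
Definition normalized_analytic (f : C -> C) : Prop :=
  analytic_on unit_disc f /\ f 0%C = 0%C /\ C_derive f 0%C = 1%C.

Definition subordinate (g h : C -> C) : Prop :=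
  analytic_on unit_disc g /\ analytic_on unit_disc h /\
  exists w : C -> C,
    analytic_on unit_disc w /\
    (forall z : C, unit_disc z -> unit_disc (w z)) /\
    w 0%C = 0%C /\
    (forall z : C, unit_disc z -> g z = h (w z)).

(* [z f'(z) / f(z)] with its removable singularity at [0] filled in; the value
   there is [1] when [f 0 = 0] and [f' 0 = 1]. *)
Definition star_quotient (f : C -> C) (z : C) : C :=
  if Ceq_dec z 0%C then 1%C else (z * C_derive f z / f z)%C.

Definition phi_cs (a : R) (z : C) : C :=
  (1 + z / ((1 - z) * (1 + RtoC a * z)))%C.

(* Since [x / 0 = 0] in [C], it is required explicitly that the quotient
   [z f'(z) / f(z)] be defined away from [0]. *)
Definition class_cs (a : R) (f : C -> C) : Prop :=
  normalized_analytic f /\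
  (forall z : C, unit_disc z -> z <> 0%C -> f z <> 0%C) /\
  subordinate (star_quotient f) (phi_cs a).

Definition pre_schwarzian (f : C -> C) (z : C) : C :=
  (C_derive (C_derive f) z / C_derive f z)%C.

Definition pre_schwarzian_norm (f : C -> C) : Rbar :=
  Lub_Rbar (fun x : R => exists z : C,
    unit_disc z /\ x = (1 - Cmod z ^ 2) * Cmod (pre_schwarzian f z)).

(* Main.v *)
Require Import Defs.
From Stdlib Require Import Reals Lra Lia Psatz List Classical ClassicalEpsilon.
From Coquelicot Require Import Coquelicot.
Open Scope R_scope.

(** Let [w] be the Schwarz function of [f], so that [z f' / f = phi (w z)] with
    [phi = 1 + z / q], [q z = (1 - z) (1 + a z)].  Taking the logarithmic
    derivative gives

      [f'' / f' = w / (z q(w)) + w' phi'(w) / phi(w)].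

    Multiply by [1 - |z|^2] and bound the two summands separately.  The Schwarz
    lemma [|w| <= |z|] bounds the first one by [(1 - |w|^2) / |q(w)|], which is
    at most [2 / (1 + a)].  The Schwarz-Pick inequality
    [(1 - |z|^2) |w'| <= 1 - |w|^2] bounds the second one by
    [(1 - |w|^2) |phi'(w) / phi(w)|].  For [a <= 1 / 2] the function [phi] has
    positive real part on the disc, so this is at most [2], again by
    Schwarz-Pick, here for maps into a half-plane; for the explicit [phi] it is
    a polynomial inequality.  The sum of the bounds is [2 (2 + a) / (1 + a)].
    The two inequalities for [phi] are [phi_cs_bounds], the identity for [f'']
    is [class_cs_derivative_equations].

    For sharpness take [w z = z], that is [f z = z g z] with [q g' = g] and
    [g 0 = 1]; then [(1 - x^2) P_f x] tends to the constant as the real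
    number [x] tends to [1].

    Schwarz-Pick is derived from the maximum modulus principle.  That principle
    needs no integration: if [f] has an expansion of order three at [t], then
    the mean of [f] over [t + h, t - h, t + i h, t - i h] is [f t + O(h^3)],
    whereas the mean of [|z|^2] is [|t|^2 + h^2]; hence
    [Re (zeta f) + eps |z|^2] has no interior local maximum.

    The function [g] is a power series with coefficients in the closed unit
    disc.  Its analyticity at the other points of the disc follows by solving
    the same differential equation there, and comparing solutions: if
    [q f' = lam f] and [q g' = - lam g] then [f g] is constant.  The same remark
    shows that [g] has no zeros. *)

(** * Germs with Taylor expansions *)

(** Neighbourhoods are expressed through the increment [h], so that germs at all
    points of the plane are germs at [0]. *)
Definition near (P : C -> Prop) : Prop :=
  exists d : R, 0 < d /\ forall h : C, Cmod h < d -> P h.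

Lemma near_and (P Q : C -> Prop) :
  near P -> near Q -> near (fun h => P h /\ Q h).
Proof.
intros [d [Hd HP]] [e [He HQ]].
exists (Rmin d e); split; [now apply Rmin_glb_lt|].
intros h Hh; split.
- apply HP; eapply Rlt_le_trans; [exact Hh|apply Rmin_l].
- apply HQ; eapply Rlt_le_trans; [exact Hh|apply Rmin_r].
Qed.

Lemma near_imp (P Q : C -> Prop) :
  (forall h, P h -> Q h) -> near P -> near Q.
Proof. intros H [d [Hd HP]]; exists d; auto. Qed.

Lemma near_small (e : R) : 0 < e -> near (fun h => Cmod h < e).
Proof. intros He; exists e; auto. Qed.

Lemma near_at_0 (P : C -> Prop) : near P -> P 0%C.
Proof. intros [d [Hd HP]]; apply HP; now rewrite Cmod_0. Qed.

Definition bounded_near (g : C -> C) : Prop :=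
  exists K : R, near (fun h => Cmod (g h) <= K).

(** A Taylor expansion of order [n] at [0] with remainder [O(h^n)], encoded by
    iterated divided differences: closure under products and inverses is then an
    induction on [n] that never mentions the coefficients. *)
Fixpoint jet (n : nat) (g : C -> C) : Prop :=
  match n with
  | O => bounded_near g
  | S m => exists (c : C) (g1 : C -> C),
      jet m g1 /\ near (fun h => g h = (c + h * g1 h)%C)
  end.

Lemma jet_ext (n : nat) (f g : C -> C) :
  near (fun h => f h = g h) -> jet n f -> jet n g.
Proof.
intros Hfg; destruct n as [|n].
- intros [K HK]; exists K.
  apply (near_imp (fun h => f h = g h /\ Cmod (f h) <= K)); [|now apply near_and].
  now intros h [<- H].
- intros [c [f1 [Hf1 Hf]]]; exists c, f1; split; [exact Hf1|].
  eapply near_imp; [|exact (near_and _ _ Hfg Hf)].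
  intros h [<- H]; exact H.
Qed.

Lemma bounded_near_plus (f g : C -> C) :
  bounded_near f -> bounded_near g -> bounded_near (fun h => (f h + g h)%C).
Proof.
intros [K HK] [L HL]; exists (K + L).
eapply near_imp; [|exact (near_and _ _ HK HL)].
intros h [H1 H2]; eapply Rle_trans; [apply Cmod_triangle|lra].
Qed.

Lemma bounded_near_mult (f g : C -> C) :
  bounded_near f -> bounded_near g -> bounded_near (fun h => (f h * g h)%C).
Proof.
intros [K HK] [L HL]; exists (K * L).
eapply near_imp; [|exact (near_and _ _ HK HL)].
intros h [H1 H2]; rewrite Cmod_mult.
apply Rmult_le_compat; auto using Cmod_ge_0.
Qed.

Lemma bounded_near_const (c : C) : bounded_near (fun _ => c).
Proof. exists (Cmod c), 1; split; [lra|intros; lra]. Qed.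

Lemma bounded_near_id : bounded_near (fun h => h).
Proof. exists 1, 1; split; [lra|intros h Hh; lra]. Qed.

Lemma jet_pred (n : nat) : forall g : C -> C, jet (S n) g -> jet n g.
Proof.
induction n as [|n IH]; intros g [c [g1 [Hg1 Hg]]].
- apply (jet_ext 0 (fun h => (c + h * g1 h)%C)).
  + eapply near_imp; [|exact Hg]; auto.
  + apply bounded_near_plus; [apply bounded_near_const|].
    apply bounded_near_mult; [apply bounded_near_id|exact Hg1].
- exists c, g1; split; [now apply IH|exact Hg].
Qed.

Lemma jet_const (n : nat) : forall c : C, jet n (fun _ => c).
Proof.
induction n as [|n IH]; intros c; [apply bounded_near_const|].
exists c, (fun _ => 0%C); split; [apply IH|].
exists 1; split; [lra|intros; ring].
Qed.

Lemma jet_id (n : nat) : jet n (fun h => h).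
Proof.
destruct n as [|n]; [apply bounded_near_id|].
exists 0%C, (fun _ => 1%C); split; [apply jet_const|].
exists 1; split; [lra|intros; ring].
Qed.

Lemma jet_plus (n : nat) : forall f g : C -> C,
  jet n f -> jet n g -> jet n (fun h => (f h + g h)%C).
Proof.
induction n as [|n IH]; intros f g; [apply bounded_near_plus|].
intros [c [f1 [Hf1 Hf]]] [d [g1 [Hg1 Hg]]].
exists (c + d)%C, (fun h => (f1 h + g1 h)%C); split; [now apply IH|].
eapply near_imp; [|exact (near_and _ _ Hf Hg)].
intros h [-> ->]; ring.
Qed.

(** Leibniz rule for divided differences: [(f g - c d) / h = c g1 + f1 g], where
    [g] itself is only needed to order [n]. *)
Lemma jet_mult (n : nat) : forall f g : C -> C,
  jet n f -> jet n g -> jet n (fun h => (f h * g h)%C).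
Proof.
induction n as [|n IH]; intros f g; [apply bounded_near_mult|].
intros [c [f1 [Hf1 Hf]]] Hg0.
assert (Hg' := jet_pred n g Hg0).
destruct Hg0 as [d [g1 [Hg1 Hg]]].
exists (c * d)%C, (fun h => (c * g1 h + f1 h * g h)%C); split.
- apply jet_plus; apply IH; auto using jet_const.
- eapply near_imp; [|exact (near_and _ _ Hf Hg)].
  intros h [-> ->]; ring.
Qed.

Lemma Cmod_rev_triangle (x y : C) : Cmod x - Cmod y <= Cmod (x + y)%C.
Proof.
assert (H := Cmod_triangle (x + y)%C (- y)%C).
replace (x + y + - y)%C with x in H by ring.
rewrite Cmod_opp in H; lra.
Qed.

(** An expansion of order one forces continuity at [0]. *)
Lemma jet_away_from_0 (f : C -> C) :
  f 0%C <> 0%C -> jet 1 f -> near (fun h => Cmod (f 0%C) / 2 <= Cmod (f h)).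
Proof.
intros Hf0 [c [f1 [[K HK] Hf]]].
assert (Hc : f 0%C = c) by (rewrite (near_at_0 _ Hf); ring).
rewrite Hc in Hf0 |- *. assert (Hc0 := proj1 (Cmod_gt_0 c) Hf0).
assert (HK0 : 0 <= K)
  by (eapply Rle_trans; [apply Cmod_ge_0|apply (near_at_0 _ HK)]).
assert (He : 0 < Cmod c / (2 * (K + 1))) by (apply Rdiv_lt_0_compat; lra).
eapply near_imp;
  [|exact (near_and _ _ (near_and _ _ HK Hf) (near_small _ He))].
intros h [[H1 H2] H3].
rewrite H2; eapply Rle_trans; [|apply Cmod_rev_triangle].
rewrite Cmod_mult.
assert (H : Cmod h * Cmod (f1 h) <= Cmod c / (2 * (K + 1)) * (K + 1))
  by (apply Rmult_le_compat; auto using Cmod_ge_0; lra).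
replace (Cmod c / (2 * (K + 1)) * (K + 1)) with (Cmod c / 2) in H
  by (field; lra).
lra.
Qed.

(** One order is lost because a bounded germ may come arbitrarily close to [0]:
    already the case [n = 0] uses continuity of [f].  The step is
    [(1 / f - 1 / c) / h = - f1 / (c f)]. *)
Lemma jet_inv (n : nat) : forall f : C -> C,
  f 0%C <> 0%C -> jet (S n) f -> jet n (fun h => (/ f h)%C).
Proof.
induction n as [|n IH]; intros f Hf0 Hf.
- assert (Hc0 := proj1 (Cmod_gt_0 _) Hf0).
  exists (2 / Cmod (f 0%C)).
  eapply near_imp; [|exact (jet_away_from_0 f Hf0 Hf)].
  intros h H; rewrite Cmod_inv by (apply Cmod_gt_0; lra).
  replace (2 / Cmod (f 0%C)) with (/ (Cmod (f 0%C) / 2)) by (field; lra).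
  apply Rinv_le_contravar; lra.
- assert (Hi := IH f Hf0 (jet_pred _ _ Hf)).
  assert (Haway : near (fun h => Cmod (f 0%C) / 2 <= Cmod (f h))).
  { apply jet_away_from_0; [exact Hf0|].
    clear - Hf; induction n; [now apply jet_pred|]; apply IHn; now apply jet_pred. }
  destruct Hf as [c [f1 [Hf1 Hf]]].
  assert (Hc : f 0%C = c) by (rewrite (near_at_0 _ Hf); ring).
  rewrite Hc in Hf0, Haway. assert (Hc0 := proj1 (Cmod_gt_0 c) Hf0).
  exists (/ c)%C, (fun h => (- / c * (f1 h * / f h))%C); split.
  + apply jet_mult; [apply jet_const|].
    apply jet_mult; [now apply jet_pred|exact Hi].
  + eapply near_imp; [|exact (near_and _ _ Haway Hf)].
    intros h [H1 H2].
    assert (H3 : f h <> 0%C) by (apply Cmod_gt_0; lra).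
    rewrite H2 in H3 |- *; field; auto.
Qed.

Definition jets (f : C -> C) (z : C) : Prop :=
  forall n : nat, jet n (fun h => f (z + h)%C).

Lemma jets_const (c z : C) : jets (fun _ => c) z.
Proof. intros n; apply jet_const. Qed.

Lemma jets_id (z : C) : jets (fun x => x) z.
Proof. intros n; apply jet_plus; [apply jet_const|apply jet_id]. Qed.

Lemma jets_plus (f g : C -> C) (z : C) :
  jets f z -> jets g z -> jets (fun x => (f x + g x)%C) z.
Proof.
intros Hf Hg n.
apply (jet_plus n (fun h => f (z + h)%C) (fun h => g (z + h)%C)); auto.
Qed.

Lemma jets_mult (f g : C -> C) (z : C) :
  jets f z -> jets g z -> jets (fun x => (f x * g x)%C) z.
Proof.
intros Hf Hg n.
apply (jet_mult n (fun h => f (z + h)%C) (fun h => g (z + h)%C)); auto.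
Qed.

Lemma jets_inv (f : C -> C) (z : C) :
  f z <> 0%C -> jets f z -> jets (fun x => (/ f x)%C) z.
Proof.
intros Hz Hf n.
apply (jet_inv n (fun h => f (z + h)%C)); [|apply Hf].
now rewrite Cplus_0_r.
Qed.

Lemma jets_ext (f g : C -> C) (z : C) :
  near (fun h => f (z + h)%C = g (z + h)%C) -> jets f z -> jets g z.
Proof. intros H Hf n; eapply jet_ext; [exact H|apply Hf]. Qed.

Lemma jets_lipschitz (f : C -> C) (z : C) : jets f z ->
  exists K, near (fun h => Cmod (f (z + h) - f z)%C <= K * Cmod h).
Proof.
intros Hf; destruct (Hf 1%nat) as [c [f1 [[K HK] H]]].
assert (Hc := near_at_0 _ H); cbv beta in Hc.
replace (z + 0)%C with z in Hc by ring.
exists K; eapply near_imp; [|exact (near_and _ _ HK H)].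
intros h [H1 H2]; rewrite H2, Hc.
replace (c + h * f1 h - (c + 0 * f1 0))%C with (f1 h * h)%C by ring.
rewrite Cmod_mult; apply Rmult_le_compat_r; auto using Cmod_ge_0.
Qed.

(** * The maximum modulus principle *)

Lemma Cmod_sqr (z : C) : Cmod z ^ 2 = fst z ^ 2 + snd z ^ 2.
Proof. exact (Cmod2_alt z). Qed.

Lemma Cmod_lt_coords (z : C) (d : R) : 0 < d ->
  Rabs (fst z) < d / 2 -> Rabs (snd z) < d / 2 -> Cmod z < d.
Proof.
intros Hd H1 H2.
assert (H : Cmod z ^ 2 < d ^ 2).
{ rewrite Cmod_sqr.
  apply Rabs_def2 in H1; apply Rabs_def2 in H2; nra. }
assert (0 <= Cmod z) by apply Cmod_ge_0. nra.
Qed.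

Lemma coords_le_Cmod (z : C) : Rabs (fst z) <= Cmod z /\ Rabs (snd z) <= Cmod z.
Proof.
assert (H := Rmax_Cmod z); split; eapply Rle_trans; [| exact H | | exact H].
- apply Rmax_l.
- apply Rmax_r.
Qed.

(** Heine-Borel form of the extreme value theorem.  Finitely many of the
    neighbourhoods cover the disc; the point with the largest of the finitely many
    values [u t'] lies in one of them, so it is exceeded by one of these values. *)
Lemma disc_not_all_exceeded (u : C -> R) (rho : R) : 0 <= rho ->
  (forall t, Cmod t <= rho -> exists t', Cmod t' <= rho /\
     near (fun h => u (t + h)%C < u t')) -> False.
Proof.
intros Hrho H.
assert (Hd : forall t : C, exists p : posreal * C,
  Cmod (snd p) <= rho /\
  forall x : C, Cmod x <= rho ->
    Rabs (fst x - fst t) < fst p -> Rabs (snd x - snd t) < fst p -> u x < u (snd p)).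
{ intros t; destruct (Rle_lt_dec (Cmod t) rho) as [Ht|Ht].
  - destruct (H t Ht) as [t' [Ht' [d [Hd1 Hd2]]]].
    assert (Hd3 : 0 < d / 2) by lra.
    exists (mkposreal _ Hd3, t'); simpl; split; [exact Ht'|].
    intros x Hx H1 H2.
    replace x with (t + (x - t))%C by ring.
    apply Hd2, Cmod_lt_coords; auto.
  - assert (Hd3 : 0 < (Cmod t - rho) / 2) by lra.
    exists (mkposreal _ Hd3, RtoC 0); simpl; split; [rewrite Cmod_0; lra|].
    intros x Hx H1 H2. exfalso.
    assert (Cmod (x - t)%C < Cmod t - rho) by (apply Cmod_lt_coords; auto; lra).
    assert (H4 := Cmod_rev_triangle t (x - t)%C).
    replace (t + (x - t))%C with x in H4 by ring. lra. }
destruct (choice _ Hd) as [F HF].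
apply (compactness_list 2 (- rho, (- rho, tt)) (rho, (rho, tt))
  (fun t => fst (F (fst t, fst (snd t))))).
intros [l Hl].
assert (Hmax : exists m, Cmod m <= rho /\
  forall t, In t l -> u (snd (F (fst t, fst (snd t)))) <= u m).
{ clear Hl; induction l as [|t l [m [Hm IH]]].
  - exists 0%C; split; [rewrite Cmod_0; lra|]; intros t [].
  - set (m' := snd (F (fst t, fst (snd t)))).
    destruct (Rle_lt_dec (u m') (u m)) as [Hle|Hlt].
    + exists m; split; [exact Hm|]; intros s [<-|Hs]; [exact Hle|auto].
    + exists m'; split; [apply HF|].
      intros s [<-|Hs]; [apply Rle_refl|]. apply Rlt_le, (Rle_lt_trans _ (u m)); auto. }
destruct Hmax as [m [Hm Hmax]].
destruct (coords_le_Cmod m) as [Hm1 Hm2].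
assert (Hb1 : - rho <= fst m <= rho) by (apply Rabs_le_between; lra).
assert (Hb2 : - rho <= snd m <= rho) by (apply Rabs_le_between; lra).
destruct (Hl (fst m, (snd m, tt))) as [[t1 [t2 []]] [Ht [_ Hc]]].
{ simpl; auto. }
simpl in Hc; destruct Hc as [Hc1 [Hc2 _]].
assert (Hlt := proj2 (HF (t1, t2)) m Hm Hc1 Hc2).
assert (Hle := Hmax _ Ht); simpl in Hle. lra.
Qed.

(** The powers of [i] sum to zero, and so do their squares; hence the terms of
    degree one and two cancel. *)
Lemma four_point_average (g : C -> C) : jet 3 g ->
  exists K d, 0 <= K /\ 0 < d /\ forall t : R, 0 < t < d ->
    Cmod (g (RtoC t) + g (- RtoC t) + g (Ci * RtoC t) + g (- (Ci * RtoC t)) - 4 * g 0)%C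
      <= 4 * K * t ^ 3.
Proof.
intros [c0 [g1 [[c1 [g2 [[c2 [g3 [[K HK] H3]]] H2]]] H1]]].
assert (HK0 : 0 <= K) by (eapply Rle_trans; [apply Cmod_ge_0|apply (near_at_0 _ HK)]).
destruct (near_and _ _ (near_and _ _ H1 H2) (near_and _ _ H3 HK)) as [d [Hd H]].
exists K, d; split; [exact HK0|split; [exact Hd|]].
assert (E : forall h, Cmod h < d ->
  g h = (c0 + c1 * h + c2 * h ^ 2 + h ^ 3 * g3 h)%C /\ Cmod (g3 h) <= K).
{ intros h Hh; destruct (H h Hh) as [[-> ->] [-> HK3]]; split; [ring|exact HK3]. }
intros t [Ht0 Htd].
assert (M1 : Cmod (RtoC t) = t) by (rewrite Cmod_R; apply Rabs_pos_eq; lra).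
assert (M2 : Cmod (Ci * RtoC t)%C = t) by (rewrite Cmod_mult, Cmod_Ci, M1; ring).
destruct (E (RtoC t)) as [E1 B1]; [now rewrite M1|].
destruct (E (- RtoC t)%C) as [E2 B2]; [now rewrite Cmod_opp, M1|].
destruct (E (Ci * RtoC t)%C) as [E3 B3]; [now rewrite M2|].
destruct (E (- (Ci * RtoC t))%C) as [E4 B4]; [now rewrite Cmod_opp, M2|].
destruct (E 0%C) as [E0 _]; [now rewrite Cmod_0|].
rewrite E0, E1, E2, E3, E4.
assert (Ci2 : (Ci * Ci = -1)%C).
{ unfold Ci, Cmult, RtoC; simpl; f_equal; ring. }
match goal with |- Cmod ?e <= _ =>
  replace e with (RtoC t ^ 3 * ((g3 (RtoC t) + - g3 (- RtoC t))
    + - Ci * (g3 (Ci * RtoC t) + - g3 (- (Ci * RtoC t)))))%C end.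
2:{ set (x1 := g3 (RtoC t)); set (x2 := g3 _); set (x3 := g3 _); set (x4 := g3 _); set (x0 := g3 0%C).
  transitivity (RtoC t ^ 3 * (x1 + - x2) + Ci * (Ci * Ci) * RtoC t ^ 3 * (x3 + - x4)
     + 2 * c2 * (RtoC t)^2 * (1 + Ci * Ci))%C.
  - rewrite Ci2; ring.
  - ring. }
rewrite Cmod_mult, Cmod_pow, M1.
assert (Hb : Cmod ((g3 (RtoC t) + - g3 (- RtoC t))
    + - Ci * (g3 (Ci * RtoC t) + - g3 (- (Ci * RtoC t))))%C <= 4 * K).
{ eapply Rle_trans; [apply Cmod_triangle|].
  rewrite Cmod_mult, Cmod_opp, Cmod_Ci, Rmult_1_l.
  assert (A1 := Cmod_triangle (g3 (RtoC t)) (- g3 (- RtoC t))%C).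
  assert (A2 := Cmod_triangle (g3 (Ci * RtoC t)%C) (- g3 (- (Ci * RtoC t)))%C).
  rewrite Cmod_opp in A1, A2. lra. }
assert (0 < t ^ 3) by (apply pow_lt; lra). nra.
Qed.

(** Suppose [|f z1| > M] and rotate so that [zeta f z1 > 0].  For small [eps] the
    function [Re (zeta f) + eps |z|^2] is larger at [z1] than on the circle, and by
    [four_point_average] it has no local maximum inside: the mean of its second
    summand over the four points exceeds the central value by [eps s^2], while the
    mean of the first one changes by [O(s^3)].  This contradicts
    [disc_not_all_exceeded]. *)
Lemma max_modulus (f : C -> C) (rho M : R) : 0 <= rho ->
  (forall z, Cmod z <= rho -> jets f z) ->
  (forall z, Cmod z = rho -> Cmod (f z) <= M) ->
  forall z, Cmod z <= rho -> Cmod (f z) <= M.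
Proof.
intros Hrho Hf HM z1 Hz1; apply Rnot_lt_le; intros Hlt.
assert (Hf0 : 0 < Cmod (f z1)).
{ destruct (Rle_lt_or_eq_dec _ _ (Cmod_ge_0 (f z1))) as [H|H]; [exact H|exfalso].
  assert (H1 : Cmod (RtoC rho) = rho) by (rewrite Cmod_R; now apply Rabs_pos_eq).
  assert (H2 := HM _ H1). assert (H3 := Cmod_ge_0 (f (RtoC rho))). lra. }
set (zeta := (Cconj (f z1) / RtoC (Cmod (f z1)))%C).
assert (Hnz : RtoC (Cmod (f z1)) <> 0%C).
{ intros E; apply RtoC_inj in E; lra. }
assert (Hzeta : Cmod zeta = 1).
{ unfold zeta; rewrite Cmod_div, Cmod_conj, Cmod_R, Rabs_pos_eq; auto; try lra.
  field; lra. }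
assert (Hz : (zeta * f z1)%C = RtoC (Cmod (f z1))).
{ unfold zeta; replace (Cconj (f z1) / RtoC (Cmod (f z1)) * f z1)%C
    with ((f z1 * Cconj (f z1)) / RtoC (Cmod (f z1)))%C by (field; auto).
  rewrite <- Cmod2_conj, RtoC_pow; field; auto. }
set (eps := (Cmod (f z1) - M) / (2 * (rho ^ 2 + 1))).
assert (Hrho2 : 0 <= rho ^ 2) by nra.
assert (Heps : 0 < eps) by (apply Rdiv_lt_0_compat; lra).
assert (Heps2 : eps * (rho ^ 2 + 1) = (Cmod (f z1) - M) / 2) by (unfold eps; field; lra).
assert (HRe : forall x : C, Re (zeta * x)%C <= Cmod x).
{ intros x; eapply Rle_trans; [apply Rle_abs|].
  eapply Rle_trans; [apply re_le_Cmod|]. rewrite Cmod_mult, Hzeta; lra. }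
set (u := fun z : C => Re (zeta * f z)%C + eps * Cmod z ^ 2).
assert (Hu1 : Cmod (f z1) <= u z1).
{ unfold u; rewrite Hz, re_RtoC. assert (0 <= Cmod z1 ^ 2) by nra. nra. }
assert (Hcont : forall t, Cmod t <= rho -> forall v, u t < v ->
   near (fun h => u (t + h)%C < v)).
{ intros t Ht v Hv.
  destruct (jets_lipschitz f t (Hf t Ht)) as [K HK].
  set (L := Rabs K + eps * (2 * Cmod t + 1) + 1).
  assert (Ht0 := Cmod_ge_0 t). assert (HKa := Rle_abs K).  assert (HKp := Rabs_pos K).
  assert (HL : 0 < L) by (unfold L; nra).
  assert (He : 0 < (v - u t) / L) by (apply Rdiv_lt_0_compat; lra).
  eapply near_imp; [|exact (near_and _ _ HK (near_and _ _ (near_small 1 Rlt_0_1) (near_small _ He)))].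
  intros h [H1 [H2 H3]]. assert (Hh := Cmod_ge_0 h).
  assert (H4 : Cmod h * L < v - u t).
  { apply (Rmult_lt_compat_r L) in H3; auto.
    replace ((v - u t) / L * L) with (v - u t) in H3 by (field; lra). exact H3. }
  assert (H5 : u (t + h)%C - u t <= Cmod h * L).
  { unfold u.
    replace (zeta * f (t + h))%C with (zeta * f t + zeta * (f (t + h) - f t))%C by ring.
    rewrite re_plus. assert (H6 := HRe (f (t + h) - f t)%C).
    assert (H7 := Cmod_triangle t h). assert (H8 := Cmod_ge_0 (t + h)%C).
    assert (H9 : Cmod (t + h)%C ^ 2 - Cmod t ^ 2 <= Cmod h * (2 * Cmod t + 1)) by nra.
    assert (H10 : K * Cmod h <= Rabs K * Cmod h) by nra.
    unfold L; nra. }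
  lra. }
apply (disc_not_all_exceeded u rho Hrho).
intros t Ht.
assert (Hex : exists t', Cmod t' <= rho /\ u t < u t').
{ destruct (Rle_lt_or_eq_dec _ _ Ht) as [Hlt'|Heq].
  2:{ exists z1; split; [exact Hz1|].
      apply Rlt_le_trans with (2 := Hu1). unfold u; rewrite Heq.
      assert (H1 := HRe (f t)). assert (H2 := HM t Heq). lra. }
  destruct (four_point_average _ (Hf t Ht 3%nat)) as [K [d [HK [Hd H4]]]].
  set (s := Rmin (Rmin (d / 2) (rho - Cmod t)) (eps / (K + 1))).
  assert (Hek : 0 < eps / (K + 1)) by (apply Rdiv_lt_0_compat; lra).
  assert (Hs0 : 0 < s) by (unfold s; repeat apply Rmin_glb_lt; lra).
  assert (Hs1 : s <= d / 2) by (unfold s; eapply Rle_trans; [apply Rmin_l|apply Rmin_l]).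
  assert (Hs2 : s <= rho - Cmod t) by (unfold s; eapply Rle_trans; [apply Rmin_l|apply Rmin_r]).
  assert (Hs3 : s <= eps / (K + 1)) by (unfold s; apply Rmin_r).
  assert (Hs4 : s * K < eps).
  { apply Rlt_le_trans with (s * (K + 1)); [nra|].
    apply (Rmult_le_compat_r (K + 1)) in Hs3; [|lra].
    replace (eps / (K + 1) * (K + 1)) with eps in Hs3 by (field; lra). exact Hs3. }
  assert (Hav := H4 s ltac:(lra)).
  assert (M1 : Cmod (RtoC s) = s) by (rewrite Cmod_R; apply Rabs_pos_eq; lra).
  assert (M2 : Cmod (Ci * RtoC s)%C = s) by (rewrite Cmod_mult, Cmod_Ci, M1; ring).
  apply NNPP; intros Hno.
  assert (Hall : forall h, Cmod h = s -> u (t + h)%C <= u t).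
  { intros h Hh; apply Rnot_lt_le; intros H; apply Hno; exists (t + h)%C; split; [|exact H].
    eapply Rle_trans; [apply Cmod_triangle|]; lra. }
  assert (B1 := Hall _ M1).
  assert (B2 := Hall (- RtoC s)%C ltac:(now rewrite Cmod_opp)).
  assert (B3 := Hall _ M2).
  assert (B4 := Hall (- (Ci * RtoC s))%C ltac:(now rewrite Cmod_opp)).
  unfold u in B1, B2, B3, B4. rewrite Cmod_sqr in B1, B2, B3, B4.
  cbv beta in Hav. rewrite Cplus_0_r in Hav.
  match type of Hav with Cmod ?e <= _ => set (E := e) in Hav end.
  assert (HE : - Re (zeta * E)%C <= 4 * K * s ^ 3).
  { eapply Rle_trans; [|exact Hav].
    rewrite <- re_opp. replace (- (zeta * E))%C with (zeta * (- E))%C by ring.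
    eapply Rle_trans; [apply HRe|]. rewrite Cmod_opp; lra. }
  assert (HS : Re (zeta * E)%C = Re (zeta * f (t + RtoC s))%C + Re (zeta * f (t + - RtoC s))%C
     + Re (zeta * f (t + Ci * RtoC s))%C + Re (zeta * f (t + - (Ci * RtoC s)))%C - 4 * Re (zeta * f t)%C).
  { unfold E. rewrite <- (re_scal_l 4).
    unfold Rminus. rewrite <- re_opp, <- !re_plus. f_equal. ring. }
  rewrite HS in HE.
  assert (HQ : forall x y : R, (x + s) ^ 2 + y ^ 2 + ((x - s) ^ 2 + y ^ 2) +
      (x ^ 2 + (y + s) ^ 2) + (x ^ 2 + (y - s) ^ 2) = 4 * (x ^ 2 + y ^ 2) + 4 * s ^ 2)
    by (intros; ring).
  assert (HQ' := HQ (fst t) (snd t)).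
  rewrite Cmod_sqr in B1, B2, B3, B4.
  replace (fst (t + RtoC s)%C) with (fst t + s) in B1 by (simpl; ring).
  replace (snd (t + RtoC s)%C) with (snd t) in B1 by (simpl; ring).
  replace (fst (t + - RtoC s)%C) with (fst t - s) in B2 by (simpl; ring).
  replace (snd (t + - RtoC s)%C) with (snd t) in B2 by (simpl; ring).
  replace (fst (t + Ci * RtoC s)%C) with (fst t) in B3 by (simpl; ring).
  replace (snd (t + Ci * RtoC s)%C) with (snd t + s) in B3 by (simpl; ring).
  replace (fst (t + - (Ci * RtoC s))%C) with (fst t) in B4 by (simpl; ring).
  replace (snd (t + - (Ci * RtoC s))%C) with (snd t - s) in B4 by (simpl; ring).
  assert (H5 : eps * s ^ 2 <= K * s ^ 3) by nra.
  assert (H6 : 0 < s ^ 2) by nra. nra. }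
destruct Hex as [t' [Ht' Hlt']]. exists t'; split; [exact Ht'|].
now apply Hcont.
Qed.

(** * The Schwarz-Pick inequality *)

(** The Moebius map [(b - a) / (1 - conj a b)] preserves the disc, and its modulus
    tends to [1] as [|b|] tends to [1]. *)
Lemma pick_identity (a b : C) :
  Cmod (1 - Cconj a * b)%C ^ 2
  = Cmod (b - a)%C ^ 2 + (1 - Cmod a ^ 2) * (1 - Cmod b ^ 2).
Proof. rewrite !Cmod_sqr; simpl; ring. Qed.

Lemma pick_denominator_nonzero (a b : C) :
  Cmod a < 1 -> Cmod b < 1 -> (1 - Cconj a * b)%C <> 0%C.
Proof.
intros Ha Hb; apply Cmod_gt_0.
assert (H := pick_identity a b).
assert (Ha0 := Cmod_ge_0 a). assert (Hb0 := Cmod_ge_0 b).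
assert (H0 := Cmod_ge_0 (1 - Cconj a * b)%C).
destruct (Rle_lt_or_eq_dec _ _ H0) as [H1|H1]; [exact H1|exfalso].
rewrite <- H1 in H. assert (0 < (1 - Cmod a ^ 2) * (1 - Cmod b ^ 2)) by
 (apply Rmult_lt_0_compat; nra).
nra.
Qed.

(** The value [l] fills the removable singularity at [z0]. *)
Definition slope (w : C -> C) (z0 l z : C) : C :=
  if Ceq_dec z z0 then l else ((w z - w z0) / (z - z0))%C.

Lemma near_neq (z z0 : C) : z <> z0 -> near (fun h => (z + h)%C <> z0).
Proof.
intros H; exists (Cmod (z - z0)%C); split.
- apply Cmod_gt_0; now apply Cminus_eq_contra.
- intros h Hh E. replace (z - z0)%C with (- h)%C in Hh by (rewrite <- E; ring).
  rewrite Cmod_opp in Hh; lra.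
Qed.

Lemma jets_slope (w : C -> C) (z0 l z : C) :
  z <> z0 -> jets w z -> jets (slope w z0 l) z.
Proof.
intros Hz Hw.
apply (jets_ext (fun x => ((w x + - w z0) * / (x + - z0))%C)).
- eapply near_imp; [|exact (near_neq z z0 Hz)].
  intros h Hh; unfold slope.
  destruct (Ceq_dec (z + h) z0); [contradiction|reflexivity].
- apply jets_mult; [apply jets_plus; auto using jets_const|].
  apply jets_inv; [now apply Cminus_eq_contra|].
  apply jets_plus; auto using jets_const, jets_id.
Qed.

(** The quotient [G] of the Moebius images of [w z] and of [z] has modulus at most
    [1 + (1 - rho^2) / (rho - m)^2] on the circle of radius [rho], hence inside it
    by the maximum principle; let [rho] tend to [1]. *)
Lemma schwarz_pick (w : C -> C) :
  (forall z, Cmod z < 1 -> jets w z) ->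
  (forall z, Cmod z < 1 -> exists l, jets (slope w z l) z) ->
  (forall z, Cmod z < 1 -> Cmod (w z) < 1) ->
  forall z0 z, Cmod z0 < 1 -> Cmod z < 1 ->
    Cmod (w z - w z0)%C * Cmod (1 - Cconj z0 * z)%C
    <= Cmod (1 - Cconj (w z0) * w z)%C * Cmod (z - z0)%C.
Proof.
intros Hw Hsl Hself z0 z Hz0 Hz.
destruct (Ceq_dec z z0) as [->|Hne].
{ replace (w z0 - w z0)%C with (RtoC 0) by ring.
  replace (z0 - z0)%C with (RtoC 0) by ring. rewrite Cmod_0; lra. }
destruct (Hsl z0 Hz0) as [l Hl].
set (G := fun x => (slope w z0 l x * ((1 + - Cconj z0 * x) * / (1 + - Cconj (w z0) * w x)))%C).
assert (HGj : forall x, Cmod x < 1 -> jets G x).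
{ intros x Hx; apply jets_mult.
  - destruct (Ceq_dec x z0) as [->|Hx0]; [exact Hl|apply jets_slope; auto].
  - apply jets_mult.
    + apply jets_plus; [apply jets_const|apply jets_mult; [apply jets_const|apply jets_id]].
    + apply jets_inv.
      * replace (1 + - Cconj (w z0) * w x)%C with (1 - Cconj (w z0) * w x)%C by ring.
        apply pick_denominator_nonzero; auto.
      * apply jets_plus; [apply jets_const|apply jets_mult; [apply jets_const|auto]]. }
assert (HGm : forall x, Cmod x < 1 -> x <> z0 ->
  Cmod (G x) * (Cmod (1 - Cconj (w z0) * w x)%C * Cmod (x - z0)%C)
   = Cmod (w x - w z0)%C * Cmod (1 - Cconj z0 * x)%C).
{ intros x Hx Hx0; rewrite <- !Cmod_mult; f_equal; unfold G, slope.
  destruct (Ceq_dec x z0) as [|_]; [contradiction|].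
  assert (H1 := pick_denominator_nonzero _ _ (Hself z0 Hz0) (Hself x Hx)).
  assert (H2 := Cminus_eq_contra _ _ Hx0).
  field; split; [|exact H2].
  replace (1 + - Cconj (w z0) * w x)%C with (1 - Cconj (w z0) * w x)%C by ring; exact H1. }
set (m := Rmax (Cmod z) (Cmod z0)).
assert (Hm1 : m < 1) by now apply Rmax_lub_lt.
assert (Hmz : Cmod z <= m) by apply Rmax_l.
assert (Hmz0 : Cmod z0 <= m) by apply Rmax_r.
assert (Hp0 := Cmod_ge_0 z0).
assert (Hbound : forall rho, m < rho < 1 ->
  Cmod (G z) <= 1 + (1 - rho ^ 2) / (rho - m) ^ 2).
{ intros rho [Hr1 Hr2].
  assert (Hk : 0 < (rho - m) ^ 2) by (apply pow_lt; lra).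
  set (q := (1 - rho ^ 2) / (rho - m) ^ 2).
  assert (Hq : q * (rho - m) ^ 2 = 1 - rho ^ 2) by (unfold q; field; lra).
  assert (Hq0 : 0 < q) by (apply Rdiv_lt_0_compat; nra).
  apply (max_modulus G rho); try lra.
  - intros x Hx; apply HGj; lra.
  - intros x Hx.
    assert (Hx0 : x <> z0) by (intros ->; lra).
    assert (Hx1 : Cmod x < 1) by lra.
    assert (HG := HGm x Hx1 Hx0).
    assert (P1 := pick_identity (w z0) (w x)).
    assert (P2 := pick_identity z0 x).
    assert (D1 := proj1 (Cmod_gt_0 _) (pick_denominator_nonzero _ _ (Hself z0 Hz0) (Hself x Hx1))).
    assert (D2 := proj1 (Cmod_gt_0 _) (Cminus_eq_contra _ _ Hx0)).
    assert (D3 := proj1 (Cmod_gt_0 _) (pick_denominator_nonzero _ _ Hz0 Hx1)).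
    assert (S1 := Hself x Hx1). assert (S2 := Hself z0 Hz0).
    assert (S3 := Cmod_ge_0 (w x)). assert (S4 := Cmod_ge_0 (w z0)).
    assert (S5 := Cmod_ge_0 (w x - w z0)%C). assert (S6 := Cmod_ge_0 (G x)).
    assert (A1 : Cmod (w x - w z0)%C <= Cmod (1 - Cconj (w z0) * w x)%C).
    { assert (0 < (1 - Cmod (w z0) ^ 2) * (1 - Cmod (w x) ^ 2)) by
        (apply Rmult_lt_0_compat; nra). nra. }
    assert (A2 : rho - m <= Cmod (x - z0)%C).
    { assert (T := Cmod_rev_triangle x (- z0)%C). rewrite Cmod_opp in T.
      unfold Cminus; lra. }
    assert (A3 : Cmod (1 - Cconj z0 * x)%C <= Cmod (x - z0)%C * (1 + q)).
    { rewrite Hx in P2.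
      assert (A4 : (rho - m) ^ 2 <= Cmod (x - z0)%C ^ 2) by nra.
      assert (A5 : (1 - Cmod z0 ^ 2) * (1 - rho ^ 2) <= q * Cmod (x - z0)%C ^ 2).
      { apply Rle_trans with (1 - rho ^ 2).
        - assert (0 < 1 - rho ^ 2) by nra. nra.
        - rewrite <- Hq; apply Rmult_le_compat_l; lra. }
      assert (A6 : Cmod (1 - Cconj z0 * x)%C ^ 2 <= (Cmod (x - z0)%C * (1 + q)) ^ 2) by nra.
      assert (0 < Cmod (x - z0)%C * (1 + q)) by (apply Rmult_lt_0_compat; lra).
      nra. }
    apply Rmult_le_reg_r with (Cmod (1 - Cconj (w z0) * w x)%C * Cmod (x - z0)%C).
    + now apply Rmult_lt_0_compat.
    + rewrite HG. apply Rle_trans with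
        (Cmod (1 - Cconj (w z0) * w x)%C * (Cmod (x - z0)%C * (1 + q))).
      * apply Rmult_le_compat; lra.
      * right; ring. }
assert (HG1 : Cmod (G z) <= 1).
{ apply Rnot_lt_le; intros Hgt.
  (* With [1 - rho = e] at most half of [1 - m], the excess over [1] is at most
     [8 e / (1 - m)^2]. *)
  set (e := Rmin ((1 - m) / 2) ((Cmod (G z) - 1) * (1 - m) ^ 2 / 16)).
  assert (Hk2 : 0 < (1 - m) ^ 2) by (apply pow_lt; lra).
  assert (Hk3 : 0 < (Cmod (G z) - 1) * (1 - m) ^ 2)
    by (apply Rmult_lt_0_compat; lra).
  assert (He0 : 0 < e).
  { unfold e; apply Rmin_glb_lt; [lra|]. lra. }
  assert (He1 : e <= (1 - m) / 2) by apply Rmin_l.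
  assert (He2 : e <= (Cmod (G z) - 1) * (1 - m) ^ 2 / 16) by apply Rmin_r.
  assert (Hb := Hbound (1 - e) ltac:(lra)).
  assert (Hk4 : (1 - m) ^ 2 / 4 <= (1 - e - m) ^ 2) by nra.
  assert (H1 : (1 - (1 - e) ^ 2) / (1 - e - m) ^ 2 <= 2 * e / ((1 - m) ^ 2 / 4)).
  { unfold Rdiv at 1 3; apply Rmult_le_compat; try nra.
    - apply Rlt_le, Rinv_0_lt_compat; lra.
    - apply Rinv_le_contravar; lra. }
  assert (H2 : 2 * e / ((1 - m) ^ 2 / 4) * (1 - m) ^ 2 = 8 * e) by (field; lra).
  nra. }
rewrite <- (HGm z Hz Hne).
assert (H1 := Cmod_ge_0 (1 - Cconj (w z0) * w z)%C).
assert (H2 := Cmod_ge_0 (z - z0)%C).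
assert (0 <= Cmod (1 - Cconj (w z0) * w z)%C * Cmod (z - z0)%C) by now apply Rmult_le_pos.
nra.
Qed.

(** The quadratic error term is available for all analytic functions and makes the
    rules of calculus plain inequalities. *)
Definition cderiv (f : C -> C) (z l : C) : Prop :=
  exists K, near (fun h => Cmod (f (z + h) - f z - l * h)%C <= K * Cmod h ^ 2).

Lemma le_of_near_le (x y Q : R) :
  near (fun h => h <> 0%C -> x <= y + Q * Cmod h) -> x <= y.
Proof.
intros [d [Hd H]]; apply Rnot_lt_le; intros Hlt.
set (t := Rmin (d / 2) ((x - y) / (2 * (Rabs Q + 1)))).
assert (HQ := Rabs_pos Q). assert (HQ' := Rle_abs Q).
assert (H0 : 0 < (x - y) / (2 * (Rabs Q + 1))) by (apply Rdiv_lt_0_compat; lra).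
assert (Ht0 : 0 < t) by (apply Rmin_glb_lt; lra).
assert (Ht1 : t <= d / 2) by apply Rmin_l.
assert (Ht2 : t <= (x - y) / (2 * (Rabs Q + 1))) by apply Rmin_r.
assert (Hm : Cmod (RtoC t) = t) by (rewrite Cmod_R; apply Rabs_pos_eq; lra).
assert (Hx := H (RtoC t)); rewrite Hm in Hx.
specialize (Hx ltac:(lra) ltac:(intros E; apply RtoC_inj in E; lra)).
apply (Rmult_le_compat_r (2 * (Rabs Q + 1))) in Ht2; [|lra].
replace ((x - y) / (2 * (Rabs Q + 1)) * (2 * (Rabs Q + 1))) with (x - y) in Ht2
  by (field; lra).
nra.
Qed.

(** Divide the two-point inequality by [|z - z0|] and let [z] tend to [z0]. *)
Lemma schwarz_pick_derivative (w : C -> C) (z0 l : C) :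
  (forall z, Cmod z < 1 -> Cmod (w z) < 1) ->
  (forall z, Cmod z < 1 ->
    Cmod (w z - w z0)%C * Cmod (1 - Cconj z0 * z)%C
    <= Cmod (1 - Cconj (w z0) * w z)%C * Cmod (z - z0)%C) ->
  Cmod z0 < 1 -> cderiv w z0 l ->
  Cmod l * (1 - Cmod z0 ^ 2) <= 1 - Cmod (w z0) ^ 2.
Proof.
intros Hself HSP Hz0 [K0 HK0].
set (K := Rabs K0). assert (HK : 0 <= K) by apply Rabs_pos.
assert (HKa := Rle_abs K0).
set (A := 1 - Cmod z0 ^ 2). set (B := 1 - Cmod (w z0) ^ 2).
set (L := Cmod l). assert (HL : 0 <= L) by apply Cmod_ge_0.
assert (Hz00 := Cmod_ge_0 z0). assert (Hw0 := Hself z0 Hz0).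
assert (Hw00 := Cmod_ge_0 (w z0)).
assert (HA : 0 < A) by (unfold A; nra).
assert (HA1 : A <= 1) by (unfold A; nra).
assert (HB : 0 < B) by (unfold B; nra).
apply (le_of_near_le _ _ (L + K + K + L)).
eapply near_imp; [|exact (near_and _ _ HK0 (near_and _ _ (near_small 1 Rlt_0_1)
  (near_and _ _ (near_small (1 - Cmod z0) ltac:(lra)) (near_small A HA))))].
intros h [H1 [H2 [H3 H4]]] Hh.
apply Cmod_gt_0 in Hh. set (t := Cmod h) in *.
assert (Hz : Cmod (z0 + h)%C < 1).
{ eapply Rle_lt_trans; [apply Cmod_triangle|]. fold t; lra. }
assert (S := HSP _ Hz).
replace (z0 + h - z0)%C with h in S by ring. fold t in S.
set (D := (w (z0 + h) - w z0)%C) in *.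
assert (H5 : Cmod (D - l * h)%C <= K * t ^ 2) 
  by (eapply Rle_trans; [exact H1|apply Rmult_le_compat_r; [apply pow2_ge_0|exact HKa]]).
assert (HD1 : L * t - K * t ^ 2 <= Cmod D).
{ assert (T := Cmod_rev_triangle (l * h) (D - l * h)%C).
  replace (l * h + (D - l * h))%C with D in T by ring.
  rewrite Cmod_mult in T. fold L t in T. lra. }
assert (HD2 : Cmod D <= L * t + K * t ^ 2).
{ assert (T := Cmod_triangle (l * h) (D - l * h)%C).
  replace (l * h + (D - l * h))%C with D in T by ring.
  rewrite Cmod_mult in T. fold L t in T. lra. }
assert (HN : A - t <= Cmod (1 - Cconj z0 * (z0 + h))%C).
{ replace (1 - Cconj z0 * (z0 + h))%C with (RtoC A + - (Cconj z0 * h))%C.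
  - eapply Rle_trans; [|apply Cmod_rev_triangle].
    rewrite Cmod_opp, Cmod_mult, Cmod_conj, Cmod_R, Rabs_pos_eq by lra. fold t; nra.
  - unfold A. rewrite RtoC_minus, Cmod2_conj. ring. }
assert (HE : Cmod (1 - Cconj (w z0) * w (z0 + h))%C <= B + Cmod D).
{ replace (1 - Cconj (w z0) * w (z0 + h))%C with (RtoC B + - (Cconj (w z0) * D))%C.
  - eapply Rle_trans; [apply Cmod_triangle|].
    rewrite Cmod_opp, Cmod_mult, Cmod_conj, Cmod_R, Rabs_pos_eq by lra.
    assert (HD0 := Cmod_ge_0 D). nra.
  - unfold B, D. rewrite RtoC_minus, Cmod2_conj. ring. }
assert (HD0 := Cmod_ge_0 D).
assert (F1 : (L * t - K * t ^ 2) * (A - t) <= (B + Cmod D) * t).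
{ eapply Rle_trans; [|eapply Rle_trans; [exact S|apply Rmult_le_compat_r; lra]].
  apply Rle_trans with (Cmod D * (A - t)); [apply Rmult_le_compat_r; lra|].
  apply Rmult_le_compat_l; lra. }
assert (F2 : t * ((L - K * t) * (A - t)) <= t * (B + (L * t + K * t ^ 2))) by nra.
apply Rmult_le_reg_l in F2; [|exact Hh].
assert (F3 : K * t * A <= K * t) by (assert (0 <= K * t) by nra; nra).
assert (F4 : K * t ^ 2 <= K * t) by (assert (t ^ 2 <= t) by nra; nra).
nra.
Qed.

(** * Complex power series *)

(** The sum of a series in the normed module over which analyticity is defined. *)
Definition csum (a : nat -> C) (l : C) : Prop :=
  @is_series C_AbsRing C_NormedModule a l.

Lemma csum_ext (a b : nat -> C) (l : C) :
  (forall n, a n = b n) -> csum a l -> csum b l.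
Proof. apply is_series_ext. Qed.

Lemma csum_plus (a b : nat -> C) (l m : C) :
  csum a l -> csum b m -> csum (fun n => (a n + b n)%C) (l + m)%C.
Proof. apply (@is_series_plus C_AbsRing C_NormedModule). Qed.

Lemma csum_scal (c : C) (a : nat -> C) (l : C) :
  csum a l -> csum (fun n => (c * a n)%C) (c * l)%C.
Proof. apply (@is_series_scal C_AbsRing C_NormedModule). Qed.

Lemma csum_tail (a : nat -> C) (l : C) :
  csum a l -> csum (fun n => a (S n)) (l - a 0%nat)%C.
Proof.
intros H; apply (@is_series_incr_1 C_AbsRing C_NormedModule).
change (csum a (l - a 0%nat + a 0%nat)%C).
now replace (l - a 0%nat + a 0%nat)%C with l by ring.
Qed.

Lemma csum_cons (a : nat -> C) (l : C) :
  csum (fun n => a (S n)) l -> csum a (l + a 0%nat)%C.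
Proof.
intros H; apply (@is_series_decr_1 C_AbsRing C_NormedModule).
change (csum (fun n => a (S n)) (l + a 0%nat - a 0%nat)%C).
now replace (l + a 0%nat - a 0%nat)%C with l by ring.
Qed.

Lemma csum_unique (a : nat -> C) (l m : C) : csum a l -> csum a m -> l = m.
Proof.
apply (@filterlim_locally_unique nat C_AbsRing C_NormedModule eventually _).
Qed.

Lemma csum_Cmod_le (a : nat -> C) (l : C) (b : nat -> R) (s : R) :
  (forall n, Cmod (a n) <= b n) -> csum a l -> is_series b s -> Cmod l <= s.
Proof.
intros Hab Ha Hb.
apply (@filterlim_le nat eventually _
  (fun n => Cmod (sum_n (G := C_AbelianMonoid) a n)) (sum_n b) (Cmod l) s).
- exists 0%nat; intros n _.
  eapply Rle_trans; [apply (@norm_sum_n_m C_AbsRing C_NormedModule)|].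
  apply sum_n_m_le; exact Hab.
- eapply filterlim_comp; [exact Ha|].
  apply (@filterlim_norm C_AbsRing C_NormedModule).
- exact Hb.
Qed.

Lemma csum_exists (a : nat -> C) (b : nat -> R) :
  (forall n, Cmod (a n) <= b n) -> ex_series b -> exists l, csum a l.
Proof.
intros Hab Hb.
exact (@ex_series_le C_AbsRing C_CompleteNormedModule a b Hab Hb).
Qed.

Lemma csum_bounded_terms (a : nat -> C) (l : C) :
  csum a l -> exists M, forall n, Cmod (a n) <= M.
Proof.
intros H.
destruct (@filterlim_bounded C_AbsRing C_NormedModule (sum_n a)) as [M HM].
{ exists l; exact H. }
exists (M + M); intros n.
change (forall n, Cmod (sum_n (G := C_AbelianMonoid) a n) <= M) in HM.
destruct n as [|n].
- assert (H0 := HM 0%nat); rewrite sum_O in H0.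
  assert (H1 := Cmod_ge_0 (a 0%nat)); lra.
- assert (H0 := HM n). assert (H1 := HM (S n)); rewrite sum_Sn in H1.
  change (Cmod (sum_n (G := C_AbelianMonoid) a n + a (S n))%C <= M) in H1.
  assert (H2 := Cmod_rev_triangle (a (S n)) (sum_n (G := C_AbelianMonoid) a n)).
  rewrite Cplus_comm in H2; lra.
Qed.

Definition psum (c : nat -> C) (r : R) (f : C -> C) : Prop :=
  forall h : C, Cmod h < r -> csum (fun n => (c n * h ^ n)%C) (f h).

Lemma is_pseries_csum (c : nat -> C) (h l : C) :
  @is_pseries C_AbsRing C_NormedModule c h l
  <-> csum (fun n => (c n * h ^ n)%C) l.
Proof.
assert (E : forall n, scal (pow_n (K := C_Ring) h n) (c n) = (c n * h ^ n)%C).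
{ intros n; transitivity (h ^ n * c n)%C; [|apply Cmult_comm].
  change (@mult C_Ring (pow_n (K := C_Ring) h n) (c n) = @mult C_Ring (h ^ n)%C (c n)).
  apply (f_equal (fun x => @mult C_Ring x (c n))).
  induction n as [|n IH]; [reflexivity|].
  rewrite Cpow_S, <- IH; reflexivity. }
split; intros H; (eapply is_series_ext; [|exact H]); intros n.
- apply E.
- symmetry; apply E.
Qed.

Lemma analytic_at_psum (f : C -> C) (z0 : C) :
  analytic_at f z0 <->
  exists c r, 0 < r /\ psum c r (fun h => f (z0 + h)%C).
Proof.
split.
- intros [c [r H]]; exists c, r; split; [apply cond_pos|].
  intros h Hh; apply (proj1 (is_pseries_csum c h (f (z0 + h)%C))).
  assert (E : (z0 + h - z0)%C = h) by ring.
  rewrite <- E at 1; apply H; now rewrite E.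
- intros [c [r [Hr H]]]; exists c, (mkposreal r Hr).
  intros z Hz; apply is_pseries_csum.
  replace (f z) with (f (z0 + (z - z0))%C) by (f_equal; ring).
  now apply H.
Qed.

Lemma csum_at_0 (c : nat -> C) : csum (fun n => (c n * 0 ^ n)%C) (c 0%nat).
Proof.
replace (c 0%nat) with (0 + c 0%nat * 0 ^ 0)%C by (simpl; ring).
apply (csum_cons (fun n => (c n * 0 ^ n)%C) 0%C).
apply (csum_ext (fun _ => 0%C)).
- intros n; simpl; ring.
- destruct (csum_exists (fun _ => 0%C) (fun n => 0 ^ n)) as [l Hl].
  + intros n; rewrite Cmod_0; apply pow_le; lra.
  + exists (/ (1 - 0)); apply is_series_geom; rewrite Rabs_R0; lra.
  + assert (Hl' := csum_scal 0%C _ _ Hl).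
    replace (0 * l)%C with (RtoC 0) in Hl' by ring.
    eapply csum_ext; [|exact Hl']; intros n; simpl; ring.
Qed.

Lemma psum_at_0 (c : nat -> C) (r : R) (f : C -> C) :
  0 < r -> psum c r f -> f 0%C = c 0%nat.
Proof.
intros Hr H; eapply csum_unique; [apply H; now rewrite Cmod_0|apply csum_at_0].
Qed.

Lemma psum_coef_bound (c : nat -> C) (r rho : R) (f : C -> C) :
  0 <= rho < r -> psum c r f -> exists M, forall n, Cmod (c n) * rho ^ n <= M.
Proof.
intros [H0 H1] H.
assert (E : Cmod (RtoC rho) = rho) by (rewrite Cmod_R; now apply Rabs_pos_eq).
destruct (csum_bounded_terms _ _ (H (RtoC rho) ltac:(now rewrite E))) as [M HM].
exists M; intros n. specialize (HM n).
now rewrite Cmod_mult, Cmod_pow, E in HM.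
Qed.

Definition quotient_at_0 (c : nat -> C) (f : C -> C) (h : C) : C :=
  if Ceq_dec h 0%C then c 1%nat else ((f h - c 0%nat) / h)%C.

(** Removability of the singularity of the divided difference at [0]. *)
Lemma psum_shift (c : nat -> C) (r : R) (f : C -> C) : psum c r f ->
  psum (fun n => c (S n)) r (quotient_at_0 c f).
Proof.
intros H h Hh; unfold quotient_at_0; destruct (Ceq_dec h 0%C) as [->|Hh0].
- apply (csum_at_0 (fun n => c (S n))).
- assert (H1 := csum_tail _ _ (H h Hh)).
  replace ((f h - c 0%nat) / h)%C with (/ h * (f h - c 0%nat * h ^ 0))%C
    by (simpl; field; exact Hh0).
  eapply csum_ext; [|exact (csum_scal (/ h)%C _ _ H1)].
  intros n; simpl; field; exact Hh0.
Qed.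

(** The terms at radius [r / 2] are bounded, so at radius [r / 4] they are dominated
    by a geometric series. *)
Lemma psum_bounded_near (c : nat -> C) (r : R) (f : C -> C) :
  0 < r -> psum c r f -> bounded_near f.
Proof.
intros Hr H.
destruct (psum_coef_bound c r (r / 2) f ltac:(lra) H) as [M HM].
exists (M * / (1 - / 2)), (r / 4); split; [lra|].
intros h Hh.
apply (csum_Cmod_le (fun n => (c n * h ^ n)%C) (f h) (fun n => M * (/ 2) ^ n)).
- intros n; rewrite Cmod_mult, Cmod_pow.
  apply Rle_trans with (Cmod (c n) * (r / 2) ^ n * (/ 2) ^ n).
  + rewrite Rmult_assoc, <- Rpow_mult_distr.
    apply Rmult_le_compat_l; [apply Cmod_ge_0|].
    apply pow_incr; split; [apply Cmod_ge_0|lra].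
  + apply Rmult_le_compat_r; [apply pow_le; lra|apply HM].
- apply H; lra.
- apply (is_series_scal M (fun n => (/ 2) ^ n)).
  apply is_series_geom; rewrite Rabs_pos_eq; lra.
Qed.

Lemma psum_jet (n : nat) : forall (c : nat -> C) (r : R) (f : C -> C),
  0 < r -> psum c r f -> jet n f.
Proof.
induction n as [|n IH]; intros c r f Hr H.
- exact (psum_bounded_near c r f Hr H).
- exists (c 0%nat), (quotient_at_0 c f); split.
  + apply (IH _ r _ Hr (psum_shift c r f H)).
  + exists r; split; [exact Hr|]; intros h Hh; unfold quotient_at_0.
    destruct (Ceq_dec h 0%C) as [->|Hh0].
    * rewrite (psum_at_0 c r f Hr H); ring.
    * field; exact Hh0.
Qed.

Lemma analytic_jets (f : C -> C) (z : C) : analytic_at f z -> jets f z.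
Proof.
intros H; apply analytic_at_psum in H; destruct H as [c [r [Hr H]]].
intros n; exact (psum_jet n c r _ Hr H).
Qed.

Lemma analytic_jets_slope (f : C -> C) (z : C) :
  analytic_at f z -> exists l, jets (slope f z l) z.
Proof.
intros H; apply analytic_at_psum in H; destruct H as [c [r [Hr H]]].
exists (c 1%nat); intros n.
apply (jet_ext n (quotient_at_0 c (fun h => f (z + h)%C))).
- exists 1; split; [lra|]; intros h _; unfold quotient_at_0, slope.
  assert (E := psum_at_0 _ _ _ Hr H); cbv beta in E; rewrite Cplus_0_r in E.
  destruct (Ceq_dec h 0%C) as [->|Hh0]; destruct (Ceq_dec (z + _)%C z) as [Hz|Hz].
  + reflexivity.
  + exfalso; apply Hz; ring.
  + exfalso; apply Hh0. replace h with (z + h - z)%C by ring. rewrite Hz; ring.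
  + rewrite E; f_equal; ring.
- exact (psum_jet n _ r _ Hr (psum_shift _ _ _ H)).
Qed.

(** With [E] the error for exponent [n + 2], the error for the next exponent is
    [(z + h) E + (n + 2) z^(n + 1) h^2]. *)
Lemma pow_taylor_error (z h : C) (R0 : R) (n : nat) :
  Cmod z <= R0 -> Cmod (z + h)%C <= R0 ->
  Cmod ((z + h) ^ (n + 2) - z ^ (n + 2) - RtoC (INR (n + 2)) * z ^ (n + 1) * h)%C
  <= INR (n + 2) * INR (n + 1) * R0 ^ n * Cmod h ^ 2.
Proof.
intros Hz Hzh. assert (Hz0 := Cmod_ge_0 z). assert (Hh0 := Cmod_ge_0 h).
induction n as [|n IH].
- replace ((z + h) ^ (0 + 2) - z ^ (0 + 2) - RtoC (INR (0 + 2)) * z ^ (0 + 1) * h)%C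
    with (h ^ 2)%C by (simpl; rewrite RtoC_plus; ring).
  rewrite Cmod_pow; simpl. nra.
- set (E := ((z + h) ^ (n + 2) - z ^ (n + 2) - RtoC (INR (n + 2)) * z ^ (n + 1) * h)%C) in *.
  replace ((z + h) ^ (S n + 2) - z ^ (S n + 2) - RtoC (INR (S n + 2)) * z ^ (S n + 1) * h)%C
    with ((z + h) * E + RtoC (INR (n + 2)) * z ^ (n + 1) * h ^ 2)%C.
  2:{ unfold E. replace (S n + 2)%nat with (S (n + 2)) by lia.
      replace (S n + 1)%nat with (S (n + 1)) by lia.
      replace (n + 2)%nat with (S (n + 1)) by lia.
      rewrite (S_INR (S (n + 1))), RtoC_plus. simpl (_ ^ S _)%C. ring. }
  eapply Rle_trans; [apply Cmod_triangle|].
  rewrite !Cmod_mult, !Cmod_pow, Cmod_R, (Rabs_pos_eq _ (pos_INR _)).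
  assert (HR : 0 <= R0) by lra.
  assert (Hp : Cmod z ^ (n + 1) <= R0 ^ (n + 1)) by (apply pow_incr; lra).
  assert (Hh2 : 0 <= Cmod h ^ 2) by apply pow2_ge_0.
  assert (HI := pos_INR (n + 2)).
  apply Rle_trans with (R0 * (INR (n + 2) * INR (n + 1) * R0 ^ n * Cmod h ^ 2)
     + INR (n + 2) * R0 ^ (n + 1) * Cmod h ^ 2).
  + apply Rplus_le_compat.
    * apply Rmult_le_compat; auto using Cmod_ge_0.
    * apply Rmult_le_compat_r; [exact Hh2|]. now apply Rmult_le_compat_l.
  + replace (R0 ^ (n + 1)) with (R0 * R0 ^ n) by (rewrite pow_add; simpl; ring).
    replace (S n + 2)%nat with (S (n + 2)) by lia.
    replace (S n + 1)%nat with (n + 2)%nat by lia.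
    replace (R0 ^ S n) with (R0 * R0 ^ n) by reflexivity.
    rewrite S_INR. replace (INR (n + 2)) with (INR (n + 1) + 1) by (rewrite !plus_INR; simpl; ring).
    assert (HP : 0 <= R0 * R0 ^ n * Cmod h ^ 2).
    { apply Rmult_le_pos; [apply Rmult_le_pos; [exact HR|now apply pow_le]|exact Hh2]. }
    assert (HI1 := pos_INR (n + 1)).
    set (P := R0 * R0 ^ n * Cmod h ^ 2) in *.
    replace (R0 * ((INR (n + 1) + 1) * INR (n + 1) * R0 ^ n * Cmod h ^ 2) +
      (INR (n + 1) + 1) * (R0 * R0 ^ n) * Cmod h ^ 2)
      with ((INR (n + 1) + 1) * (INR (n + 1) + 1) * P) by (unfold P; ring).
    replace ((INR (n + 1) + 1 + 1) * (INR (n + 1) + 1) * (R0 * R0 ^ n) * Cmod h ^ 2)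
      with ((INR (n + 1) + 1 + 1) * (INR (n + 1) + 1) * P) by (unfold P; ring).
    apply Rmult_le_compat_r; [exact HP|nra].
Qed.

Definition derived_coef (c : nat -> C) (n : nat) : C :=
  (RtoC (INR (S n)) * c (S n))%C.

(** Termwise differentiation.  By [pow_taylor_error] the error is at most [|h|^2]
    times the second derivative, at a radius [R0] below [r], of the real series
    with coefficients [|c n|]. *)
Lemma psum_derive (c : nat -> C) (r : R) (f : C -> C) : 0 < r -> psum c r f ->
  exists f' : C -> C, psum (derived_coef c) r f' /\
    forall z, Cmod z < r -> cderiv f z (f' z).
Proof.
intros Hr H.
set (b := fun n => Cmod (c n)).
assert (Hrad : forall x, 0 <= x < r -> Rbar_lt (Rabs x) (CV_radius b)).
{ intros x Hx; rewrite Rabs_pos_eq by lra.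
  destruct (psum_coef_bound c r ((x + r) / 2) f ltac:(lra) H) as [M HM].
  apply Rbar_lt_le_trans with ((x + r) / 2); [simpl; lra|].
  apply (CV_radius_bounded b). exists M; intros n.
  rewrite Rabs_pos_eq; [apply HM|].
  apply Rmult_le_pos; [apply Cmod_ge_0|apply pow_le; lra]. }
assert (Hser : forall x, 0 <= x < r ->
  ex_series (fun n => PS_derive b n * x ^ n)).
{ intros x Hx. destruct (ex_pseries_derive b x (Hrad x Hx)) as [l Hl].
  exists l. exact (proj1 (is_pseries_R _ _ _) Hl). }
assert (Hser2 : forall x, 0 <= x < r ->
  ex_series (fun n => PS_derive (PS_derive b) n * x ^ n)).
{ intros x Hx. destruct (ex_pseries_derive (PS_derive b) x) as [l Hl].
  - rewrite CV_radius_derive; auto.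
  - exists l. exact (proj1 (is_pseries_R _ _ _) Hl). }
assert (Hf' : forall h, exists l,
  Cmod h < r -> csum (fun n => (derived_coef c n * h ^ n)%C) l).
{ intros h; destruct (Rlt_le_dec (Cmod h) r) as [Hh|Hh].
  - destruct (csum_exists (fun n => (derived_coef c n * h ^ n)%C)
      (fun n => PS_derive b n * Cmod h ^ n)) as [l Hl].
    + intros n; unfold derived_coef, PS_derive, b.
      rewrite !Cmod_mult, Cmod_pow, Cmod_R, (Rabs_pos_eq _ (pos_INR _)). lra.
    + apply Hser; split; [apply Cmod_ge_0|exact Hh].
    + exists l; auto.
  - exists 0%C; intros; lra. }
destruct (choice _ Hf') as [f' Hf'1].
exists f'; split; [exact Hf'1|].
intros z Hz.
set (R0 := (Cmod z + r) / 2).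
assert (Hz0 := Cmod_ge_0 z).
destruct (Hser2 R0) as [T HT]; [unfold R0; lra|].
exists T, ((r - Cmod z) / 2); split; [lra|].
intros h Hh.
assert (Hzh : Cmod (z + h)%C <= R0).
{ eapply Rle_trans; [apply Cmod_triangle|]; unfold R0; lra. }
assert (H1 := H (z + h)%C ltac:(unfold R0 in Hzh; lra)).
assert (H2 := H z Hz). assert (H3 := Hf'1 z Hz).
assert (H4 := csum_tail _ _ (csum_plus _ _ _ _ H1 (csum_scal (-1)%C _ _ H2))).
assert (H5 := csum_tail _ _ (csum_plus _ _ _ _ H4 (csum_scal (- h)%C _ _ H3))).
cbv beta in H5.
match type of H5 with csum _ ?l => replace l with (f (z + h) - f z - f' z * h)%C in H5 end.
2:{ unfold derived_coef; simpl; ring. }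
apply (csum_Cmod_le _ _ (fun n => Cmod h ^ 2 * (PS_derive (PS_derive b) n * R0 ^ n)) _) with (2 := H5).
- intros n.
  match goal with |- Cmod ?e <= _ => replace e with
   (c (n + 2)%nat * ((z + h) ^ (n + 2) - z ^ (n + 2) - RtoC (INR (n + 2)) * z ^ (n + 1) * h))%C end.
  2:{ unfold derived_coef. replace (n + 2)%nat with (S (S n)) by lia.
      replace (n + 1)%nat with (S n) by lia. simpl (_ ^ S _)%C. ring. }
  rewrite Cmod_mult.
  eapply Rle_trans; [apply Rmult_le_compat_l; [apply Cmod_ge_0|]|].
  { apply (pow_taylor_error z h R0 n); [unfold R0; lra|exact Hzh]. }
  unfold PS_derive, b. replace (n + 2)%nat with (S (S n)) by lia.
  replace (n + 1)%nat with (S n) by lia. right; ring.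
- rewrite (Rmult_comm T). apply (is_series_scal (Cmod h ^ 2) _ T HT).
Qed.

(** * Complex derivatives *)

Lemma cderiv_is_derive (f : C -> C) (z l : C) :
  cderiv f z l -> @is_derive C_AbsRing C_NormedModule f z l.
Proof.
intros [K [d [Hd HK]]]; split.
- apply (@is_linear_scal_l C_AbsRing C_NormedModule).
- intros x Hx.
  assert (Ex : z = x)
    by exact (@is_filter_lim_locally_unique C_AbsRing (AbsRing_NormedModule C_AbsRing) z x Hx).
  subst x; intros eps.
  assert (He : 0 < Rmin d (eps / (Rabs K + 1))).
  { apply Rmin_glb_lt; [exact Hd|].
    apply Rdiv_lt_0_compat; [apply cond_pos|]. assert (H := Rabs_pos K); lra. }
  exists (mkposreal _ He).
  change (forall y : C, Cmod (y - z)%C < Rmin d (eps / (Rabs K + 1)) ->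
    Cmod (f y - f z - (y - z) * l)%C <= eps * Cmod (y - z)%C).
  intros y Hy.
  assert (Hy1 : Cmod (y - z)%C < d) by (eapply Rlt_le_trans; [exact Hy|apply Rmin_l]).
  assert (Hy2 : Cmod (y - z)%C < eps / (Rabs K + 1))
    by (eapply Rlt_le_trans; [exact Hy|apply Rmin_r]).
  specialize (HK _ Hy1).
  replace (z + (y - z))%C with y in HK by ring.
  replace (f y - f z - (y - z) * l)%C with (f y - f z - l * (y - z))%C by ring.
  eapply Rle_trans; [exact HK|].
  assert (Hn := Cmod_ge_0 (y - z)%C). assert (Ha := Rle_abs K). assert (Hp := Rabs_pos K).
  apply (Rmult_lt_compat_r (Rabs K + 1)) in Hy2; [|lra].
  replace (eps / (Rabs K + 1) * (Rabs K + 1)) with (pos eps) in Hy2 by (field; lra).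
  nra.
Qed.

Lemma cderiv_C_derive (f : C -> C) (z l : C) : cderiv f z l -> C_derive f z = l.
Proof. intros H; now apply is_C_derive_unique, cderiv_is_derive. Qed.

Lemma cderiv_unique (f : C -> C) (z l m : C) : cderiv f z l -> cderiv f z m -> l = m.
Proof.
intros Hl Hm. now rewrite <- (cderiv_C_derive _ _ _ Hl), (cderiv_C_derive _ _ _ Hm).
Qed.

Lemma cderiv_ext (f g : C -> C) (z l : C) :
  near (fun h => f (z + h)%C = g (z + h)%C) -> cderiv f z l -> cderiv g z l.
Proof.
intros Hfg [K HK]; exists K.
assert (H0 := near_at_0 _ Hfg); cbv beta in H0; rewrite !Cplus_0_r in H0.
eapply near_imp; [|exact (near_and _ _ Hfg HK)].
intros h [H1 H2]; now rewrite <- H1, <- H0.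
Qed.

Lemma cderiv_const (c z : C) : cderiv (fun _ => c) z 0%C.
Proof.
exists 0, 1; split; [lra|]; intros h _.
replace (c - c - 0 * h)%C with (RtoC 0) by ring. rewrite Cmod_0; lra.
Qed.

Lemma cderiv_id (z : C) : cderiv (fun x => x) z 1%C.
Proof.
exists 0, 1; split; [lra|]; intros h _.
replace (z + h - z - 1 * h)%C with (RtoC 0) by ring. rewrite Cmod_0; lra.
Qed.

Lemma cderiv_plus (f g : C -> C) (z l m : C) :
  cderiv f z l -> cderiv g z m -> cderiv (fun x => (f x + g x)%C) z (l + m)%C.
Proof.
intros [K HK] [L HL]; exists (K + L).
eapply near_imp; [|exact (near_and _ _ HK HL)].
intros h [H1 H2].
replace (f (z + h) + g (z + h) - (f z + g z) - (l + m) * h)%C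
  with ((f (z + h) - f z - l * h) + (g (z + h) - g z - m * h))%C by ring.
eapply Rle_trans; [apply Cmod_triangle|lra].
Qed.

Lemma cderiv_mult (f g : C -> C) (z l m : C) :
  cderiv f z l -> cderiv g z m ->
  cderiv (fun x => (f x * g x)%C) z (l * g z + f z * m)%C.
Proof.
intros [K HK] [L HL].
exists (Rabs K * (Cmod (g z) + Cmod m + Rabs L)
  + (Cmod (f z) + Cmod l) * Rabs L + Cmod l * Cmod m).
eapply near_imp; [|exact (near_and _ _ (near_and _ _ HK HL) (near_small 1 Rlt_0_1))].
intros h [[H1 H2] H3].
set (r1 := (f (z + h) - f z - l * h)%C) in *.
set (r2 := (g (z + h) - g z - m * h)%C) in *.
replace (f (z + h) * g (z + h) - f z * g z - (l * g z + f z * m) * h)%C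
  with (r1 * (g z + m * h + r2) + ((f z + l * h) * r2 + l * m * h ^ 2))%C
  by (unfold r1, r2; ring).
assert (Hh := Cmod_ge_0 h). assert (Hm := Cmod_ge_0 m). assert (Hl := Cmod_ge_0 l).
assert (Hg := Cmod_ge_0 (g z)). assert (Hf := Cmod_ge_0 (f z)).
assert (HKa := Rle_abs K). assert (HLa := Rle_abs L).
assert (HKp := Rabs_pos K). assert (HLp := Rabs_pos L).
set (t := Cmod h) in *.
assert (Ht2 : 0 <= t ^ 2) by apply pow2_ge_0.
assert (Ht3 : t ^ 2 <= 1) by nra.
assert (B1 : Cmod r1 <= Rabs K * t ^ 2) by (apply Rle_trans with (1 := H1); nra).
assert (B2 : Cmod r2 <= Rabs L * t ^ 2) by (apply Rle_trans with (1 := H2); nra).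
assert (B3 : Cmod (g z + m * h + r2)%C <= Cmod (g z) + Cmod m + Rabs L).
{ eapply Rle_trans; [apply Cmod_triangle|].
  assert (T := Cmod_triangle (g z) (m * h)%C). rewrite Cmod_mult in T. fold t in T. nra. }
assert (B4 : Cmod (f z + l * h)%C <= Cmod (f z) + Cmod l).
{ eapply Rle_trans; [apply Cmod_triangle|]. rewrite Cmod_mult. fold t. nra. }
eapply Rle_trans; [apply Cmod_triangle|].
rewrite Cmod_mult.
assert (C1 : Cmod r1 * Cmod (g z + m * h + r2)%C
  <= Rabs K * t ^ 2 * (Cmod (g z) + Cmod m + Rabs L))
  by (apply Rmult_le_compat; auto using Cmod_ge_0).
assert (C2 := Cmod_triangle ((f z + l * h) * r2)%C (l * m * h ^ 2)%C).
rewrite !Cmod_mult, Cmod_pow in C2. fold t in C2.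
assert (C3 : Cmod (f z + l * h)%C * Cmod r2 <= (Cmod (f z) + Cmod l) * (Rabs L * t ^ 2))
  by (apply Rmult_le_compat; auto using Cmod_ge_0).
lra.
Qed.

Lemma cderiv_lipschitz (f : C -> C) (z l : C) : cderiv f z l ->
  exists K, near (fun h => Cmod (f (z + h) - f z)%C <= K * Cmod h).
Proof.
intros [K HK]; exists (Cmod l + Rabs K).
eapply near_imp; [|exact (near_and _ _ HK (near_small 1 Rlt_0_1))].
intros h [H1 H2].
replace (f (z + h) - f z)%C with (l * h + (f (z + h) - f z - l * h))%C by ring.
eapply Rle_trans; [apply Cmod_triangle|]. rewrite Cmod_mult.
assert (Hh := Cmod_ge_0 h). assert (Ha := Rle_abs K). assert (Hp := Rabs_pos K).
assert (Hh2 : Cmod h ^ 2 <= Cmod h) by nra.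
assert (Hh3 : 0 <= Cmod h ^ 2) by nra. nra.
Qed.

(** Inside the disc of convergence the derivative is the termwise derived series,
    so it is analytic again. *)
Lemma analytic_at_derive (f : C -> C) (z0 : C) : analytic_at f z0 ->
  cderiv f z0 (C_derive f z0) /\ analytic_at (C_derive f) z0.
Proof.
intros H; apply analytic_at_psum in H; destruct H as [c [r [Hr H]]].
destruct (psum_derive c r _ Hr H) as [f' [Hf' Hd]].
assert (Hd' : forall h, Cmod h < r -> cderiv f (z0 + h)%C (f' h)).
{ intros h Hh; destruct (Hd h Hh) as [K HK]; exists K.
  eapply near_imp; [|exact HK]; intros k Hk.
  cbv beta in Hk |- *; now rewrite Cplus_assoc in Hk. }
assert (Hder : forall h, Cmod h < r -> C_derive f (z0 + h)%C = f' h)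
  by (intros h Hh; apply cderiv_C_derive; auto).
assert (H0 : Cmod 0%C < r) by now rewrite Cmod_0.
split.
- rewrite <- (Cplus_0_r z0), (Hder _ H0); auto.
- apply analytic_at_psum; exists (derived_coef c), r; split; [exact Hr|].
  intros h Hh; rewrite (Hder h Hh); auto.
Qed.

Lemma schwarz_pick_analytic (w : C -> C) (z : C) :
  analytic_on unit_disc w -> (forall x, unit_disc x -> unit_disc (w x)) ->
  w 0%C = 0%C -> unit_disc z ->
  Cmod (w z) <= Cmod z /\
  Cmod (C_derive w z) * (1 - Cmod z ^ 2) <= 1 - Cmod (w z) ^ 2.
Proof.
intros Hw Hself Hw0 Hz.
assert (HSP := schwarz_pick w (fun x Hx => analytic_jets w x (Hw x Hx))
  (fun x Hx => analytic_jets_slope w x (Hw x Hx)) Hself).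
split.
- assert (H := HSP 0%C z ltac:(rewrite Cmod_0; lra) Hz).
  rewrite Hw0 in H.
  replace (w z - 0)%C with (w z) in H by ring.
  replace (z - 0)%C with z in H by ring.
  replace (Cconj 0) with (RtoC 0) in H by (unfold Cconj, RtoC; simpl; f_equal; ring).
  replace (1 - 0 * z)%C with (RtoC 1) in H by ring.
  replace (1 - 0 * w z)%C with (RtoC 1) in H by ring.
  rewrite Cmod_1 in H; lra.
- apply (schwarz_pick_derivative w z (C_derive w z) Hself); [|exact Hz|].
  + intros x Hx; now apply HSP.
  + now apply analytic_at_derive, Hw.
Qed.

(** Here [phi w = (q + w) / q] and [phi' w = (1 + a w^2) / q^2], so the last
    inequality says [(1 - |w|^2) |phi' w| <= 2 |phi w|].  It is proved in the
    stronger form with [2 Re (phi w)] on the right, which holds because [phi] maps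
    the disc into the right half-plane.  The decomposition
    [(1 + a) (1 + a w^2) = (1 + a w)^2 + a (1 - w)^2] reduces it to a polynomial
    inequality in [Re w] and [|w|]. *)
Lemma phi_cs_bounds (a : R) (w q : C) : 0 < a <= 1 / 2 -> Cmod w < 1 ->
  q = ((1 - w) * (1 + RtoC a * w))%C ->
  0 < Cmod q /\ 0 < Cmod (q + w)%C /\
  (1 - Cmod w ^ 2) * (1 + a) <= 2 * Cmod q /\
  (1 - Cmod w ^ 2) * Cmod (1 + RtoC a * w ^ 2)%C <= 2 * (Cmod q * Cmod (q + w)%C).
Proof.
intros [Ha0 Ha1] Hw Hq.
assert (Hw0 := Cmod_ge_0 w). set (s := Cmod w) in *.
assert (HQ : (1 - s) * (1 + a * s) <= Cmod q).
{ replace q with (1 + - (RtoC (1 - a) * w + RtoC a * w ^ 2))%C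
    by (rewrite Hq, RtoC_minus; ring).
  eapply Rle_trans; [|apply Cmod_rev_triangle].
  assert (T := Cmod_triangle (RtoC (1 - a) * w)%C (RtoC a * w ^ 2)%C).
  rewrite !Cmod_mult, Cmod_pow, !Cmod_R, !Rabs_pos_eq in T by lra. fold s in T.
  rewrite Cmod_opp, Cmod_1. nra. }
assert (HQ0 : 0 < (1 - s) * (1 + a * s)) by (apply Rmult_lt_0_compat; nra).
set (A := Cmod (1 + RtoC a * w)%C ^ 2). set (B := Cmod (1 - w)%C ^ 2).
assert (HN : (1 + a) * Cmod (1 + RtoC a * w ^ 2)%C <= A + a * B).
{ unfold A, B. rewrite <- !Cmod_pow.
  replace ((1 + a) * Cmod (1 + RtoC a * w ^ 2)%C)
    with (Cmod (RtoC (1 + a) * (1 + RtoC a * w ^ 2))%C)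
    by (rewrite Cmod_mult, Cmod_R, Rabs_pos_eq; lra).
  replace (RtoC (1 + a) * (1 + RtoC a * w ^ 2))%C
    with ((1 + RtoC a * w) ^ 2 + RtoC a * (1 - w) ^ 2)%C
    by (rewrite RtoC_plus; ring).
  eapply Rle_trans; [apply Cmod_triangle|].
  rewrite (Cmod_mult (RtoC a)), Cmod_R, Rabs_pos_eq; lra. }
assert (HRe : Re ((q + w) * Cconj q)%C <= Cmod q * Cmod (q + w)%C).
{ eapply Rle_trans; [apply Rle_abs|]. eapply Rle_trans; [apply re_le_Cmod|].
  rewrite Cmod_mult, Cmod_conj; lra. }
set (x := fst w).
assert (Hx : - s <= x).
{ assert (H := proj1 (coords_le_Cmod w)). apply Rabs_le_between in H. fold x s in H. lra. }
assert (HP : 2 * (1 + a) * Re ((q + w) * Cconj q)%C - (1 - s ^ 2) * (A + a * B)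
   = B * ((1 + a) * (1 + 4 * a * x + a * (1 + 2 * a) * s ^ 2))).
{ unfold A, B, s, x. rewrite !Cmod_sqr, Hq. destruct w as [u v]; simpl. ring. }
assert (HB : 0 < B).
{ unfold B; apply pow_lt, Cmod_gt_0; intros E.
  assert (E' : Cmod w = 1) by (replace w with (RtoC 1)
    by (replace w with (1 - (1 - w))%C by ring; rewrite E; ring); apply Cmod_1).
  unfold s in Hw; lra. }
assert (HA : 0 <= A) by (unfold A; apply pow2_ge_0).
(* The minimum over the disc is approached at [w = -1], where the expression is
   [(1 - a) (1 - 2 a)]: this is where [a <= 1 / 2] enters. *)
assert (HP1 : 0 <= 1 + 4 * a * x + a * (1 + 2 * a) * s ^ 2).
{ assert (0 <= 1 - 4 * a * s + a * (1 + 2 * a) * s ^ 2).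
  { assert (0 <= (1 - a) * (1 - 2 * a)) by nra.
    assert (0 <= a * (1 - s) * (4 - (1 + 2 * a) * (1 + s))).
    { apply Rmult_le_pos; [nra|]. nra. }
    nra. }
  nra. }
assert (HP2 : (1 - s ^ 2) * (A + a * B) <= 2 * (1 + a) * Re ((q + w) * Cconj q)%C).
{ assert (0 <= B * ((1 + a) * (1 + 4 * a * x + a * (1 + 2 * a) * s ^ 2))).
  { apply Rmult_le_pos; [lra|]. apply Rmult_le_pos; lra. }
  lra. }
assert (Hs2 : 0 < 1 - s ^ 2) by nra.
assert (HAB : 0 < A + a * B) by nra.
assert (HRe0 : 0 < Re ((q + w) * Cconj q)%C).
{ assert (0 < (1 - s ^ 2) * (A + a * B)) by now apply Rmult_lt_0_compat. nra. }
assert (HS0 := Cmod_ge_0 (q + w)%C).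
split; [lra|split; [|split]].
- destruct (Rle_lt_or_eq_dec _ _ HS0) as [H|H]; [exact H|].
  rewrite <- H in HRe; lra.
- apply Rle_trans with (2 * ((1 - s) * (1 + a * s))); [|lra].
  replace ((1 - s ^ 2) * (1 + a)) with ((1 - s) * ((1 + s) * (1 + a))) by ring.
  replace (2 * ((1 - s) * (1 + a * s))) with ((1 - s) * (2 * (1 + a * s))) by ring.
  apply Rmult_le_compat_l; nra.
- apply Rmult_le_reg_l with (1 + a); [lra|].
  apply Rle_trans with ((1 - s ^ 2) * (A + a * B)).
  + replace ((1 + a) * ((1 - s ^ 2) * Cmod (1 + RtoC a * w ^ 2)%C))
      with ((1 - s ^ 2) * ((1 + a) * Cmod (1 + RtoC a * w ^ 2)%C)) by ring.
    apply Rmult_le_compat_l; lra.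
  + nra.
Qed.

(** * The bound on the pre-Schwarzian derivative *)

Lemma unit_disc_near (z : C) : unit_disc z -> near (fun h => unit_disc (z + h)%C).
Proof.
intros Hz; unfold unit_disc in *; exists (1 - Cmod z); split; [lra|].
intros h Hh; eapply Rle_lt_trans; [apply Cmod_triangle|lra].
Qed.

(** Away from [0] the defining relation is [z f' q = f (q + w)] with [q] evaluated
    at [w z].  In the form [(z f' - f) q = f w] it is polynomial in [f], [f'] and
    [w], so the product rule suffices to differentiate it; the last equation is
    [f'' / f' = w / (z q) + w' (1 + a w^2) / (q (q + w))] with the denominators
    cleared. *)
Lemma class_cs_derivative_equations (a : R) (f : C -> C) : 0 < a <= 1 / 2 ->
  class_cs a f ->
  exists w : C -> C,
    analytic_on unit_disc w /\ (forall z, unit_disc z -> unit_disc (w z)) /\ w 0%C = 0%C /\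
    forall z q, unit_disc z -> z <> 0%C -> q = ((1 - w z) * (1 + RtoC a * w z))%C ->
      f z <> 0%C /\ (C_derive f z * z * q = f z * (q + w z))%C /\
      (C_derive (C_derive f) z * (z * q * (q + w z))
       = C_derive f z * (w z * (q + w z) + z * C_derive w z * (1 + RtoC a * w z ^ 2)))%C.
Proof.
intros Ha [[Han [Hf0 Hf0']] [Hnz [_ [_ [w [Hw [Hself [Hw0 Heq]]]]]]]].
exists w; repeat (split; [assumption|]).
set (Q := fun x => ((1 + -1 * w x) * (1 + RtoC a * w x))%C).
assert (HQ : forall x, unit_disc x -> Q x <> 0%C).
{ intros x Hx.
  destruct (phi_cs_bounds a (w x) (Q x) Ha (Hself x Hx)) as [H _];
    [unfold Q; ring|now apply Cmod_gt_0]. }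
assert (HE : forall x, unit_disc x ->
  ((C_derive f x * x + -1 * f x) * Q x = f x * w x)%C).
{ intros x Hx; destruct (Ceq_dec x 0%C) as [->|Hx0].
  - rewrite Hf0; ring.
  - assert (E := Heq x Hx). unfold star_quotient, phi_cs in E.
    destruct (Ceq_dec x 0%C) as [|_]; [contradiction|].
    assert (Hfx := Hnz x Hx Hx0). assert (HQx := HQ x Hx).
    replace ((1 - w x) * (1 + RtoC a * w x))%C with (Q x) in E by (unfold Q; ring).
    assert (E1 : (x * C_derive f x = f x * (1 + w x / Q x))%C)
      by (rewrite <- E; field; exact Hfx).
    replace (C_derive f x * x)%C with (x * C_derive f x)%C by ring.
    rewrite E1; field; exact HQx. }
intros z q Hz Hz0 Hq.
assert (HqQ : Q z = q) by (rewrite Hq; unfold Q; ring).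
assert (Hqnz := HQ z Hz). rewrite HqQ in Hqnz.
destruct (analytic_at_derive f z (Han z Hz)) as [D0 A1].
destruct (analytic_at_derive _ z A1) as [D1 _].
destruct (analytic_at_derive w z (Hw z Hz)) as [DW _].
assert (DL := cderiv_mult _ _ _ _ _
  (cderiv_plus _ _ _ _ _ (cderiv_mult _ _ _ _ _ D1 (cderiv_id z))
     (cderiv_mult _ _ _ _ _ (cderiv_const (-1)%C z) D0))
  (cderiv_mult _ _ _ _ _
    (cderiv_plus _ _ _ _ _ (cderiv_const 1%C z)
       (cderiv_mult _ _ _ _ _ (cderiv_const (-1)%C z) DW))
    (cderiv_plus _ _ _ _ _ (cderiv_const 1%C z)
       (cderiv_mult _ _ _ _ _ (cderiv_const (RtoC a) z) DW)))).
assert (DR := cderiv_mult _ _ _ _ _ D0 DW).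
apply (cderiv_ext _ (fun x => (f x * w x)%C)) in DL;
  [|eapply near_imp; [|exact (unit_disc_near z Hz)]; intros h Hh; exact (HE _ Hh)].
assert (U := cderiv_unique _ _ _ _ DL DR); cbv beta in U; clear DL DR.
assert (E0 := HE z Hz). rewrite HqQ in E0.
set (F := f z) in *. set (F1 := C_derive f z) in *.
set (F2 := C_derive (C_derive f) z) in *. set (W := w z) in *.
set (W1 := C_derive w z) in *.
assert (E1 : (F1 * z * q = F * (q + W))%C).
{ transitivity ((F1 * z + -1 * F) * q + F * q)%C; [ring|rewrite E0; ring]. }
split; [now apply Hnz|split; [exact E1|]].
assert (U1 : (F2 * z * q + (F1 * z + -1 * F) * W1 * (RtoC a - 1 - 2 * RtoC a * W)
   = F1 * W + F * W1)%C).
{ rewrite <- U, Hq; ring. }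
assert (U2 : (F2 * z * q * q = F1 * W * q + F * W1 * (1 + RtoC a * W ^ 2))%C).
{ transitivity (q * (F2 * z * q + (F1 * z + -1 * F) * W1 * (RtoC a - 1 - 2 * RtoC a * W))
     - ((F1 * z + -1 * F) * q) * W1 * (RtoC a - 1 - 2 * RtoC a * W))%C; [ring|].
  rewrite U1, E0, Hq; ring. }
assert (U3 : (q * (F2 * (z * q * (q + W))) = q * (F1 * (W * (q + W) + z * W1 * (1 + RtoC a * W ^ 2))))%C).
{ transitivity ((F2 * z * q * q) * (q + W))%C; [ring|]. rewrite U2.
  transitivity (F1 * W * q * (q + W) + (F * (q + W)) * W1 * (1 + RtoC a * W ^ 2))%C; [ring|].
  rewrite <- E1; ring. }
assert (Hcancel : forall x y : C, (q * x = q * y)%C -> x = y).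
{ intros x y H. replace x with (/ q * (q * x))%C by (field; exact Hqnz).
  rewrite H; field; exact Hqnz. }
now apply Hcancel.
Qed.

(** The two summands of [f'' / f'] contribute at most [2 / (1 + a)] and [2]. *)
Lemma class_cs_pointwise_bound (a : R) (f : C -> C) (z : C) : 0 < a <= 1 / 2 ->
  class_cs a f -> unit_disc z -> z <> 0%C ->
  C_derive f z <> 0%C /\
  (1 - Cmod z ^ 2) * Cmod (C_derive (C_derive f) z)
  <= 2 * (2 + a) / (1 + a) * Cmod (C_derive f z).
Proof.
intros Ha Hf Hz Hz0.
destruct (class_cs_derivative_equations a f Ha Hf) as [w [Hw [Hself [Hw0 H]]]].
set (q := ((1 - w z) * (1 + RtoC a * w z))%C).
destruct (H z q Hz Hz0 eq_refl) as [Hfz [E1 E2]]. clear H.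
destruct (schwarz_pick_analytic w z Hw Hself Hw0 Hz) as [S1 S2].
destruct (phi_cs_bounds a (w z) q Ha (Hself z Hz) eq_refl) as [B0 [B1 [B2 B3]]].
assert (Hz1 : 0 < Cmod z) by now apply Cmod_gt_0.
split.
{ intros E. rewrite E in E1.
  assert (E3 : (f z * (q + w z))%C = 0%C) by (rewrite <- E1; ring).
  apply Cmod_gt_0 in B1. revert E3; now apply Cmult_neq_0. }
assert (E3 := f_equal Cmod E2). rewrite !Cmod_mult in E3.
assert (T := Cmod_triangle (w z * (q + w z))%C (z * C_derive w z * (1 + RtoC a * w z ^ 2))%C).
rewrite !Cmod_mult in T.
assert (P1 := Cmod_ge_0 (C_derive f z)). assert (P2 := Cmod_ge_0 (w z)).
assert (P3 := Cmod_ge_0 (C_derive w z)).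
assert (P4 := Cmod_ge_0 (1 + RtoC a * w z ^ 2)%C).
assert (Hz2 : Cmod z < 1) by exact Hz.
set (Z := Cmod z) in *. set (W := Cmod (w z)) in *. set (Q := Cmod q) in *.
set (S := Cmod (q + w z)%C) in *. set (N := Cmod (1 + RtoC a * w z ^ 2)%C) in *.
set (V := Cmod (C_derive w z)) in *. set (F1 := Cmod (C_derive f z)) in *.
set (F2 := Cmod (C_derive (C_derive f) z)) in *.
assert (HZ2 : 0 < 1 - Z ^ 2) by nra.
assert (A1 : (1 - Z ^ 2) * W * (1 + a) <= 2 * (Z * Q)).
(* The function [t / (1 - t^2)] is increasing and [W <= Z]. *)
{ assert (A : (1 - Z ^ 2) * W <= Z * (1 - W ^ 2)).
  { assert (0 <= (Z - W) * (1 + Z * W)) by (apply Rmult_le_pos; nra). nra. }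
  apply Rle_trans with (Z * ((1 - W ^ 2) * (1 + a))); nra. }
assert (A2 : (1 - Z ^ 2) * V * N <= 2 * (Q * S)).
{ apply Rle_trans with ((1 - W ^ 2) * N); [|exact B3].
  apply Rmult_le_compat_r; lra. }
assert (HZQS : 0 < Z * Q * S) by (repeat apply Rmult_lt_0_compat; lra).
apply Rmult_le_reg_l with ((1 + a) * (Z * Q * S)); [apply Rmult_lt_0_compat; lra|].
replace ((1 + a) * (Z * Q * S) * (2 * (2 + a) / (1 + a) * F1))
  with (F1 * (2 * (2 + a) * (Z * Q * S))) by (field; lra).
replace ((1 + a) * (Z * Q * S) * ((1 - Z ^ 2) * F2))
  with ((1 + a) * (1 - Z ^ 2) * (F2 * (Z * Q * S))) by ring.
rewrite E3.
apply Rle_trans with ((1 + a) * (1 - Z ^ 2) * (F1 * (W * S + Z * V * N))).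
{ apply Rmult_le_compat_l; [apply Rmult_le_pos; lra|].
  apply Rmult_le_compat_l; lra. }
replace ((1 + a) * (1 - Z ^ 2) * (F1 * (W * S + Z * V * N)))
  with (F1 * ((1 - Z ^ 2) * W * (1 + a) * S + (1 + a) * Z * ((1 - Z ^ 2) * V * N))) by ring.
apply Rmult_le_compat_l; [exact P1|].
assert (A3 : (1 - Z ^ 2) * W * (1 + a) * S <= 2 * (Z * Q) * S)
  by (apply Rmult_le_compat_r; lra).
assert (A4 : (1 + a) * Z * ((1 - Z ^ 2) * V * N) <= (1 + a) * Z * (2 * (Q * S)))
  by (apply Rmult_le_compat_l; nra).
lra.
Qed.

(** The formula for [f''] divides by [z]; the bound extends to [z = 0] because [f']
    and [f''] are continuous there. *)
Lemma class_cs_bound (a : R) (f : C -> C) (z : C) : 0 < a <= 1 / 2 ->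
  class_cs a f -> unit_disc z ->
  C_derive f z <> 0%C /\
  (1 - Cmod z ^ 2) * Cmod (pre_schwarzian f z) <= 2 * (2 + a) / (1 + a).
Proof.
intros Ha Hf Hz.
set (B := 2 * (2 + a) / (1 + a)).
assert (HB : 0 < B) by (apply Rdiv_lt_0_compat; lra).
assert (Hmain : C_derive f z <> 0%C /\
  (1 - Cmod z ^ 2) * Cmod (C_derive (C_derive f) z) <= B * Cmod (C_derive f z)).
{ destruct (Ceq_dec z 0%C) as [->|Hz0]; [|now apply class_cs_pointwise_bound].
  assert (Hf' := Hf). destruct Hf' as [[Han [_ Hd0]] _].
  destruct (analytic_at_derive f _ (Han _ Hz)) as [_ A1].
  destruct (analytic_at_derive _ _ A1) as [D1 A2].
  destruct (analytic_at_derive _ _ A2) as [D2 _].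
  destruct (cderiv_lipschitz _ _ _ D1) as [K1 HK1].
  destruct (cderiv_lipschitz _ _ _ D2) as [K2 HK2].
  rewrite Hd0, Cmod_0, Cmod_1; split; [exact C1_nz|].
  set (F := Cmod (C_derive (C_derive f) 0%C)).
  assert (HF : 0 <= F) by apply Cmod_ge_0.
  replace ((1 - 0 ^ 2) * F) with F by ring.
  apply (le_of_near_le _ _ (Rabs K2 + B * Rabs K1 + F)).
  eapply near_imp; [|exact (near_and _ _ (near_and _ _ HK1 HK2) (near_small 1 Rlt_0_1))].
  intros h [[H1 H2] H3] Hh.
  rewrite Cplus_0_l in H1, H2. rewrite Hd0 in H1.
  destruct (class_cs_pointwise_bound a f h Ha Hf H3 Hh) as [_ H4]. fold B in H4.
  assert (T1 := Cmod_triangle 1%C (C_derive f h - 1)%C).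
  replace (1 + (C_derive f h - 1))%C with (C_derive f h) in T1 by ring.
  rewrite Cmod_1 in T1.
  assert (T2 := Cmod_triangle (C_derive (C_derive f) h)
    (- (C_derive (C_derive f) h - C_derive (C_derive f) 0%C))%C).
  replace (C_derive (C_derive f) h + - (C_derive (C_derive f) h - C_derive (C_derive f) 0%C))%C
    with (C_derive (C_derive f) 0%C) in T2 by ring.
  rewrite Cmod_opp in T2. fold F in T2.
  assert (Hh0 := Cmod_ge_0 h). assert (HA1 := Rle_abs K1). assert (HA2 := Rle_abs K2).
  assert (HP1 := Rabs_pos K1). assert (HP2 := Rabs_pos K2).
  set (t := Cmod h) in *.
  assert (T3 : Cmod (C_derive f h) <= 1 + Rabs K1 * t) by nra.
  assert (T4 : F - Rabs K2 * t <= Cmod (C_derive (C_derive f) h)) by nra.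
  assert (T5 : (1 - t ^ 2) * (F - Rabs K2 * t) <= B * (1 + Rabs K1 * t)).
  { eapply Rle_trans; [|eapply Rle_trans; [exact H4|]]; [apply Rmult_le_compat_l|apply Rmult_le_compat_l]; nra. }
  assert (T6 : t ^ 2 * F <= t * F) by (apply Rmult_le_compat_r; nra).
  assert (T7 : 0 <= t ^ 2 * (Rabs K2 * t)) by (apply Rmult_le_pos; nra).
  nra. }
destruct Hmain as [Hnz Hle]; split; [exact Hnz|].
unfold pre_schwarzian; rewrite Cmod_div by exact Hnz.
apply Cmod_gt_0 in Hnz.
apply Rmult_le_reg_r with (Cmod (C_derive f z)); [exact Hnz|].
replace ((1 - Cmod z ^ 2) * (Cmod (C_derive (C_derive f) z) / Cmod (C_derive f z)) * Cmod (C_derive f z))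
  with ((1 - Cmod z ^ 2) * Cmod (C_derive (C_derive f) z)) by (field; lra).
exact Hle.
Qed.

(** * First-order linear differential equations *)

(** Two consecutive coefficients of the power series solution of
    [(A + B h + D h^2) g' = lam g] with [g 0 = 1]; the recurrence has depth two. *)
Fixpoint ode_coef_pair (A B D lam : C) (n : nat) : C * C :=
  match n with
  | O => (RtoC 1, (lam / A)%C)
  | S m =>
      let (x, y) := ode_coef_pair A B D lam m in
      (y, ((lam * y - RtoC (INR (m + 1)) * B * y - RtoC (INR m) * D * x)
           / (RtoC (INR (m + 2)) * A))%C)
  end.

Definition ode_coef (A B D lam : C) (n : nat) : C :=
  fst (ode_coef_pair A B D lam n).

Lemma ode_coef_1 (A B D lam : C) : ode_coef A B D lam 1 = (lam / A)%C.
Proof. reflexivity. Qed.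

Lemma ode_coef_SS (A B D lam : C) (m : nat) :
  ode_coef A B D lam (S (S m)) =
  ((lam * ode_coef A B D lam (S m) - RtoC (INR (m + 1)) * B * ode_coef A B D lam (S m)
    - RtoC (INR m) * D * ode_coef A B D lam m) / (RtoC (INR (m + 2)) * A))%C.
Proof.
unfold ode_coef; simpl. now destruct (ode_coef_pair A B D lam m) as [x y].
Qed.

Lemma RtoC_INR_pos (n : nat) : (0 < n)%nat -> RtoC (INR n) <> 0%C.
Proof. intros Hn E; apply RtoC_inj in E; apply lt_0_INR in Hn; lra. Qed.

Lemma ode_coef_bound (A B D lam : C) (M : R) : A <> 0%C -> 0 < M ->
  Cmod B * M + Cmod D <= Cmod A * M ^ 2 -> Cmod lam <= Cmod A * M ->
  forall n, Cmod (ode_coef A B D lam n) <= M ^ n.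
Proof.
intros HA HM H1 H2.
assert (HA0 := proj1 (Cmod_gt_0 A) HA).
assert (H : forall n, Cmod (ode_coef A B D lam n) <= M ^ n /\
  Cmod (ode_coef A B D lam (S n)) <= M ^ S n).
{ induction n as [|n [IH1 IH2]].
  - split; [unfold ode_coef; simpl; rewrite Cmod_1; lra|].
    rewrite ode_coef_1, Cmod_div by exact HA.
    apply Rmult_le_reg_r with (Cmod A); [exact HA0|].
    unfold Rdiv; rewrite Rmult_assoc, Rinv_l by lra. simpl; lra.
  - split; [exact IH2|]. rewrite ode_coef_SS.
    set (x := ode_coef A B D lam n) in *. set (y := ode_coef A B D lam (S n)) in *.
    assert (Hn := RtoC_INR_pos (n + 2) ltac:(lia)).
    rewrite Cmod_div by (now apply Cmult_neq_0).
    rewrite (Cmod_mult (RtoC _)), Cmod_R, (Rabs_pos_eq _ (pos_INR _)).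
    assert (Hn0 : 0 < INR (n + 2)) by (apply lt_0_INR; lia).
    assert (HP : 0 < INR (n + 2) * Cmod A) by now apply Rmult_lt_0_compat.
    apply Rmult_le_reg_r with (INR (n + 2) * Cmod A); [exact HP|].
    unfold Rdiv; rewrite Rmult_assoc, Rinv_l, Rmult_1_r by lra.
    assert (T1 := Cmod_triangle (lam * y - RtoC (INR (n + 1)) * B * y)%C
      (- (RtoC (INR n) * D * x))%C).
    assert (T2 := Cmod_triangle (lam * y)%C (- (RtoC (INR (n + 1)) * B * y))%C).
    rewrite Cmod_opp, !Cmod_mult, Cmod_R, (Rabs_pos_eq _ (pos_INR _)) in T1.
    rewrite Cmod_opp, !Cmod_mult in T2. rewrite Cmod_R, (Rabs_pos_eq _ (pos_INR _)) in T2.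
    eapply Rle_trans; [exact T1|].
    eapply Rle_trans; [apply Rplus_le_compat_r; exact T2|].
    assert (HB := Cmod_ge_0 B). assert (HD := Cmod_ge_0 D). assert (Hl := Cmod_ge_0 lam).
    assert (Hi := pos_INR n).
    assert (Hp : 0 < M ^ n) by now apply pow_lt.
    replace (INR (n + 1)) with (INR n + 1) by (rewrite plus_INR; simpl; ring).
    replace (INR (n + 2)) with (INR n + 2) by (rewrite plus_INR; simpl; ring).
    replace (M ^ S (S n)) with (M ^ 2 * M ^ n) by (simpl; ring).
    replace (M ^ S n) with (M * M ^ n) in IH2 by (simpl; ring).
    apply Rle_trans with (Cmod lam * (M * M ^ n) + (INR n + 1) * Cmod B * (M * M ^ n)
      + INR n * Cmod D * M ^ n).
    + apply Rplus_le_compat; [apply Rplus_le_compat|]; apply Rmult_le_compat_l; auto.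
      * apply Rmult_le_pos; lra.
      * apply Rmult_le_pos; lra.
    + replace (M ^ 2 * M ^ n * ((INR n + 2) * Cmod A))
        with (M ^ n * ((INR n + 2) * (Cmod A * M ^ 2))) by ring.
      replace (Cmod lam * (M * M ^ n) + (INR n + 1) * Cmod B * (M * M ^ n) + INR n * Cmod D * M ^ n)
        with (M ^ n * (Cmod lam * M + Cmod B * M + INR n * (Cmod B * M + Cmod D))) by ring.
      apply Rmult_le_compat_l; [lra|].
      assert (E1 : Cmod lam * M <= Cmod A * M ^ 2) by nra.
      assert (E2 : INR n * (Cmod B * M + Cmod D) <= INR n * (Cmod A * M ^ 2))
        by now apply Rmult_le_compat_l.
      lra. }
intros n; apply H.
Qed.

Definition shift_right (c : nat -> C) (n : nat) : C :=
  match n with O => 0%C | S m => c m end.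

Lemma csum_shift_right (c : nat -> C) (h l : C) :
  csum (fun n => (c n * h ^ n)%C) l ->
  csum (fun n => (shift_right c n * h ^ n)%C) (h * l)%C.
Proof.
intros H.
replace (h * l)%C with (h * l + shift_right c 0 * h ^ 0)%C by (simpl; ring).
apply (csum_cons (fun n => (shift_right c n * h ^ n)%C)).
eapply csum_ext; [|exact (csum_scal h _ _ H)]; intros n; simpl; ring.
Qed.

(** The hypotheses on [M] are those under which the recurrence preserves the bound
    [|c n| <= M^n], so the series converges for [|h| < 1 / M]. *)
Lemma linear_ode_solution (A B D lam : C) (M : R) : A <> 0%C -> 0 < M ->
  Cmod B * M + Cmod D <= Cmod A * M ^ 2 -> Cmod lam <= Cmod A * M ->
  exists (c : nat -> C) (g g' : C -> C),
    psum c (/ M) g /\ g 0%C = 1%C /\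
    forall h, Cmod h < / M ->
      cderiv g h (g' h) /\ ((A + B * h + D * h ^ 2) * g' h = lam * g h)%C.
Proof.
intros HA HM H1 H2.
set (c := ode_coef A B D lam).
assert (HM' : 0 < / M) by now apply Rinv_0_lt_compat.
assert (Hg : forall h, exists l, Cmod h < / M -> csum (fun n => (c n * h ^ n)%C) l).
{ intros h; destruct (Rlt_le_dec (Cmod h) (/ M)) as [Hh|Hh]; [|exists 0%C; intros; lra].
  assert (Hh0 := Cmod_ge_0 h).
  destruct (csum_exists (fun n => (c n * h ^ n)%C) (fun n => (M * Cmod h) ^ n)) as [l Hl].
  - intros n; rewrite Cmod_mult, Cmod_pow, Rpow_mult_distr.
    apply Rmult_le_compat_r; [now apply pow_le|].
    now apply ode_coef_bound.
  - exists (/ (1 - M * Cmod h)); apply is_series_geom.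
    rewrite Rabs_pos_eq by (apply Rmult_le_pos; lra).
    apply (Rmult_lt_compat_l M) in Hh; [|exact HM]. rewrite Rinv_r in Hh; lra.
  - exists l; auto. }
destruct (choice _ Hg) as [g Hg1].
destruct (psum_derive c (/ M) g HM' Hg1) as [g' [Hg' Hd]].
exists c, g, g'; split; [exact Hg1|split].
{ rewrite (psum_at_0 c (/ M) g HM' Hg1); reflexivity. }
intros h Hh; split; [now apply Hd|].
assert (S1 := Hg' h Hh).
assert (S2 := csum_shift_right _ _ _ S1).
assert (S3 := csum_shift_right _ _ _ S2).
assert (S4 := csum_plus _ _ _ _ (csum_scal A _ _ S1)
  (csum_plus _ _ _ _ (csum_scal B _ _ S2) (csum_scal D _ _ S3))).
replace ((A + B * h + D * h ^ 2) * g' h)%C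
  with (A * g' h + (B * (h * g' h) + D * (h * (h * g' h))))%C by ring.
apply (csum_unique _ _ _ S4).
eapply csum_ext; [|exact (csum_scal lam _ _ (Hg1 h Hh))].
intros n; cbv beta.
transitivity ((A * derived_coef c n + B * shift_right (derived_coef c) n
  + D * shift_right (shift_right (derived_coef c)) n) * h ^ n)%C; [|ring].
rewrite Cmult_assoc; f_equal.
destruct n as [|[|n]]; unfold derived_coef, shift_right.
- change (c 1%nat) with (lam / A)%C. change (c 0%nat) with (RtoC 1).
  simpl; field; exact HA.
- unfold c. rewrite ode_coef_SS. simpl. rewrite !RtoC_plus. field.
  exact HA.
- unfold c. rewrite (ode_coef_SS A B D lam (S n)).
  replace (S n + 1)%nat with (S (S n)) by lia.
  replace (S n + 2)%nat with (S (S (S n))) by lia.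
  field. split; [exact HA|]. apply RtoC_INR_pos; lia.
Qed.

(** Restrict the real and imaginary parts to the segment from [0] to [h]. *)
Lemma constant_of_zero_derivative (F : C -> C) (r : R) :
  (forall h, Cmod h < r -> cderiv F h 0%C) ->
  forall h, Cmod h < r -> F h = F 0%C.
Proof.
intros HF h Hh.
assert (Hcomp : forall p : C -> R, (forall x, Rabs (p x) <= Cmod x) ->
  (forall x y, p (x - y)%C = p x - p y) -> p (F h) = p (F 0%C)).
{ intros p Hp Hlin.
  assert (E : p (F (RtoC 0 * h)%C) = p (F (RtoC 1 * h)%C)).
  { apply (@eq_is_derive R_NormedModule (fun t => p (F (RtoC t * h)%C)) 0 1); [|lra].
    intros t Ht. apply is_derive_Reals. intros eps Heps.
    assert (Hth : Cmod (RtoC t * h)%C < r).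
    { rewrite Cmod_mult, Cmod_R, Rabs_pos_eq by lra.
      assert (H0 := Cmod_ge_0 h). nra. }
    destruct (HF _ Hth) as [K [d [Hd HK]]].
    assert (Hh0 := Cmod_ge_0 h). assert (HK0 := Rabs_pos K). assert (HKa := Rle_abs K).
    set (L := Rabs K * Cmod h ^ 2 + 1).
    assert (HL : 0 < L) by (unfold L; assert (H := pow2_ge_0 (Cmod h)); nra).
    assert (Hdel : 0 < Rmin (d / (Cmod h + 1)) (eps / L))
      by (apply Rmin_glb_lt; apply Rdiv_lt_0_compat; lra).
    exists (mkposreal _ Hdel). intros k Hk0 Hk. simpl in Hk.
    assert (Hk1 : Rabs k < d / (Cmod h + 1)) by (eapply Rlt_le_trans; [exact Hk|apply Rmin_l]).
    assert (Hk2 : Rabs k < eps / L) by (eapply Rlt_le_trans; [exact Hk|apply Rmin_r]).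
    assert (Hkp : 0 < Rabs k) by now apply Rabs_pos_lt.
    assert (Hkh : Cmod (RtoC k * h)%C < d).
    { rewrite Cmod_mult, Cmod_R. apply (Rmult_lt_compat_r (Cmod h + 1)) in Hk1; [|lra].
      replace (d / (Cmod h + 1) * (Cmod h + 1)) with d in Hk1 by (field; lra). nra. }
    assert (HKk := HK _ Hkh).
    replace (RtoC t * h + RtoC k * h)%C with (RtoC (t + k) * h)%C in HKk
      by (rewrite RtoC_plus; ring).
    replace (F (RtoC (t + k) * h) - F (RtoC t * h) - 0 * (RtoC k * h))%C
      with (F (RtoC (t + k) * h) - F (RtoC t * h))%C in HKk by ring.
    rewrite Cmod_mult, Cmod_R in HKk.
    rewrite Rminus_0_r, <- Hlin.
    unfold Rdiv; rewrite Rabs_mult, Rabs_inv.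
    apply Rmult_lt_reg_r with (Rabs k); [exact Hkp|].
    rewrite Rmult_assoc, Rinv_l, Rmult_1_r by lra.
    eapply Rle_lt_trans; [apply Hp|]. eapply Rle_lt_trans; [exact HKk|].
    apply (Rmult_lt_compat_r L) in Hk2; [|exact HL].
    replace (eps / L * L) with eps in Hk2 by (field; lra).
    assert (Hsq : 0 <= (Rabs k * Cmod h) ^ 2) by apply pow2_ge_0.
    apply Rle_lt_trans with (Rabs K * (Rabs k * Cmod h) ^ 2); [nra|].
    replace (Rabs K * (Rabs k * Cmod h) ^ 2) with (Rabs k * (Rabs K * Cmod h ^ 2) * Rabs k) by ring.
    apply Rmult_lt_compat_r; [exact Hkp|]. unfold L in Hk2. nra. }
  replace (RtoC 1 * h)%C with h in E by ring.
  replace (RtoC 0 * h)%C with (RtoC 0) in E by ring. now symmetry. }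
assert (E1 := Hcomp fst (fun x => proj1 (coords_le_Cmod x)) (fun x y => eq_refl)).
assert (E2 := Hcomp snd (fun x => proj2 (coords_le_Cmod x)) (fun x y => eq_refl)).
destruct (F h), (F 0%C); simpl in E1, E2; now subst.
Qed.

(** Since [(f g)' = (lam - lam) f g / q = 0].  Used both for the uniqueness of
    solutions and for their having no zeros. *)
Lemma opposite_odes_product (q f f' g g' : C -> C) (lam : C) (r : R) :
  (forall h, Cmod h < r -> q h <> 0%C) ->
  (forall h, Cmod h < r -> cderiv f h (f' h) /\ (q h * f' h = lam * f h)%C) ->
  (forall h, Cmod h < r -> cderiv g h (g' h) /\ (q h * g' h = - lam * g h)%C) ->
  forall h, Cmod h < r -> (f h * g h = f 0 * g 0)%C.
Proof.
intros Hq Hf Hg.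
apply (constant_of_zero_derivative (fun h => (f h * g h)%C)).
intros h Hh.
destruct (Hf h Hh) as [Df Ef]. destruct (Hg h Hh) as [Dg Eg].
assert (D := cderiv_mult _ _ _ _ _ Df Dg).
replace (RtoC 0) with (f' h * g h + f h * g' h)%C; [exact D|].
assert (Hqh := Hq h Hh).
replace (f' h * g h + f h * g' h)%C
  with (/ q h * ((q h * f' h) * g h + f h * (q h * g' h)))%C by (field; exact Hqh).
rewrite Ef, Eg; ring.
Qed.

(** * Analyticity of elementary functions *)

Lemma analytic_at_ext (f g : C -> C) (z : C) :
  near (fun h => f (z + h)%C = g (z + h)%C) -> analytic_at f z -> analytic_at g z.
Proof.
intros [d [Hd E]] H; apply analytic_at_psum in H; destruct H as [c [r [Hr H]]].
apply analytic_at_psum; exists c, (Rmin r d); split; [now apply Rmin_glb_lt|].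
intros h Hh; cbv beta; rewrite <- E.
- apply H; eapply Rlt_le_trans; [exact Hh|apply Rmin_l].
- eapply Rlt_le_trans; [exact Hh|apply Rmin_r].
Qed.

Lemma analytic_at_plus (f g : C -> C) (z : C) :
  analytic_at f z -> analytic_at g z -> analytic_at (fun x => (f x + g x)%C) z.
Proof.
intros Hf Hg; apply analytic_at_psum in Hf, Hg.
destruct Hf as [c [r [Hr Hf]]]; destruct Hg as [d [s [Hs Hg]]].
apply analytic_at_psum; exists (fun n => (c n + d n)%C), (Rmin r s).
split; [now apply Rmin_glb_lt|]; intros h Hh.
eapply csum_ext; [|apply csum_plus; [apply Hf|apply Hg]].
- intros n; simpl; ring.
- eapply Rlt_le_trans; [exact Hh|apply Rmin_l].
- eapply Rlt_le_trans; [exact Hh|apply Rmin_r].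
Qed.

Lemma analytic_at_scal (k : C) (f : C -> C) (z : C) :
  analytic_at f z -> analytic_at (fun x => (k * f x)%C) z.
Proof.
intros H; apply analytic_at_psum in H; destruct H as [c [r [Hr H]]].
apply analytic_at_psum; exists (fun n => (k * c n)%C), r; split; [exact Hr|].
intros h Hh; eapply csum_ext; [|apply csum_scal, H, Hh]; intros n; simpl; ring.
Qed.

Lemma analytic_at_id_mult (f : C -> C) (z : C) :
  analytic_at f z -> analytic_at (fun x => (x * f x)%C) z.
Proof.
intros H; apply analytic_at_psum in H; destruct H as [c [r [Hr H]]].
apply analytic_at_psum; exists (fun n => (z * c n + shift_right c n)%C), r.
split; [exact Hr|]; intros h Hh.
replace ((z + h) * f (z + h))%C with (z * f (z + h) + h * f (z + h))%C by ring.
eapply csum_ext;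
  [|exact (csum_plus _ _ _ _ (csum_scal z _ _ (H h Hh)) (csum_shift_right _ _ _ (H h Hh)))].
intros n; simpl; ring.
Qed.

Lemma csum_geom (x : C) : Cmod x < 1 -> csum (fun n => (x ^ n)%C) (/ (1 - x))%C.
Proof.
intros Hx; assert (Hx0 := Cmod_ge_0 x).
destruct (csum_exists (fun n => (x ^ n)%C) (fun n => Cmod x ^ n)) as [l Hl].
- intros n; rewrite Cmod_pow; lra.
- exists (/ (1 - Cmod x)); apply is_series_geom; now rewrite Rabs_pos_eq.
- assert (E : (l - x ^ 0)%C = (x * l)%C).
  { apply (csum_unique _ _ _ (csum_tail _ _ Hl)).
    eapply csum_ext; [|exact (csum_scal x _ _ Hl)]; intros n; reflexivity. }
  assert (Hnz : (1 - x)%C <> 0%C).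
  { apply Cmod_gt_0. assert (T := Cmod_rev_triangle 1%C (- x)%C).
    rewrite Cmod_1, Cmod_opp in T. unfold Cminus; lra. }
  replace (/ (1 - x))%C with l; [exact Hl|].
  assert (E1 : (l * (1 - x))%C = 1%C).
  { transitivity (l - x ^ 0 - x * l + 1)%C; [simpl; ring|rewrite E; ring]. }
  replace l with (l * (1 - x) * / (1 - x))%C by (field; exact Hnz).
  rewrite E1; ring.
Qed.

Lemma analytic_at_inv_affine (k z : C) :
  (1 + k * z)%C <> 0%C -> analytic_at (fun x => (/ (1 + k * x))%C) z.
Proof.
intros Hz; set (b := (1 + k * z)%C) in *.
assert (Hb := proj1 (Cmod_gt_0 b) Hz). assert (Hk := Cmod_ge_0 k).
apply analytic_at_psum; exists (fun n => (/ b * (- k / b) ^ n)%C), (Cmod b / (Cmod k + 1)).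
split; [apply Rdiv_lt_0_compat; lra|]; intros h Hh.
assert (Hkh : Cmod (- k / b * h)%C < 1).
{ rewrite Cmod_mult, Cmod_div, Cmod_opp by exact Hz.
  apply (Rmult_lt_compat_r (Cmod k + 1)) in Hh; [|lra].
  replace (Cmod b / (Cmod k + 1) * (Cmod k + 1)) with (Cmod b) in Hh by (field; lra).
  assert (H0 := Cmod_ge_0 h).
  apply Rmult_lt_reg_r with (Cmod b); [exact Hb|].
  replace (Cmod k / Cmod b * Cmod h * Cmod b) with (Cmod k * Cmod h) by (field; lra). nra. }
assert (Hnz : (1 - (- k / b * h))%C <> 0%C).
{ apply Cmod_gt_0. assert (T := Cmod_rev_triangle 1%C (- (- k / b * h))%C).
  rewrite Cmod_1, Cmod_opp in T. unfold Cminus; lra. }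
replace (/ (1 + k * (z + h)))%C with (/ b * / (1 - (- k / b * h)))%C.
- eapply csum_ext; [|exact (csum_scal (/ b)%C _ _ (csum_geom _ Hkh))].
  intros n; cbv beta; rewrite Cpow_mult_l; ring.
- assert (E : (1 + k * (z + h))%C = (b * (1 - (- k / b * h)))%C).
  { replace (1 + k * (z + h))%C with (b + k * h)%C by (unfold b; ring).
    field; exact Hz. }
  rewrite E; clear E; revert Hnz; generalize (1 - (- k / b * h))%C.
  intros x Hx; field; auto.
Qed.

Lemma analytic_at_const (k z : C) : analytic_at (fun _ => k) z.
Proof.
apply (analytic_at_ext (fun x => (k * / (1 + 0 * x))%C)).
- exists 1; split; [lra|]; intros h _.
  replace (1 + 0 * (z + h))%C with (RtoC 1) by ring. field; exact C1_nz.
- apply analytic_at_scal, analytic_at_inv_affine.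
  replace (1 + 0 * z)%C with (RtoC 1) by ring; exact C1_nz.
Qed.

Lemma analytic_at_id (z : C) : analytic_at (fun x => x) z.
Proof.
apply (analytic_at_ext (fun x => (x * 1)%C)).
- exists 1; split; [lra|]; intros h _; ring.
- apply analytic_at_id_mult, analytic_at_const.
Qed.

(** * The extremal function *)

Definition kernel_cs (a : R) (z : C) : C := ((1 - z) * (1 + RtoC a * z))%C.

Lemma kernel_cs_factors_nonzero (a : R) (z : C) : 0 < a <= 1 / 2 -> unit_disc z ->
  (1 - z)%C <> 0%C /\ (1 + RtoC a * z)%C <> 0%C /\ kernel_cs a z <> 0%C.
Proof.
intros Ha Hz; destruct (phi_cs_bounds a z (kernel_cs a z) Ha Hz eq_refl) as [H _].
apply Cmod_gt_0 in H.
split; [|split; [|exact H]]; intros E; apply H; unfold kernel_cs; rewrite E; ring.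
Qed.

(** Partial fractions:
    [(1 + a) z / ((1 - z) (1 + a z)) = 1 / (1 - z) - 1 / (1 + a z)]. *)
Lemma phi_cs_analytic (a : R) : 0 < a <= 1 / 2 -> analytic_on unit_disc (phi_cs a).
Proof.
intros Ha z Hz.
assert (Ha1 : RtoC (1 + a) <> 0%C) by (intros E; apply RtoC_inj in E; lra).
apply (analytic_at_ext (fun x =>
  (1 + / RtoC (1 + a) * (/ (1 + -1 * x) + -1 * / (1 + RtoC a * x)))%C)).
- eapply near_imp; [|exact (unit_disc_near z Hz)]; intros h Hh.
  set (x := (z + h)%C) in *.
  destruct (kernel_cs_factors_nonzero a x Ha Hh) as [H1 [H2 _]].
  assert (H3 : (1 + -1 * x)%C <> 0%C)
    by (replace (1 + -1 * x)%C with (1 - x)%C by ring; exact H1).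
  unfold phi_cs. rewrite RtoC_plus in *. field; repeat split; assumption.
- destruct (kernel_cs_factors_nonzero a z Ha Hz) as [H1 [H2 _]].
  apply analytic_at_plus; [apply analytic_at_const|].
  apply analytic_at_scal, analytic_at_plus.
  + apply analytic_at_inv_affine.
    replace (1 + -1 * z)%C with (1 - z)%C by ring; exact H1.
  + now apply analytic_at_scal, analytic_at_inv_affine.
Qed.

(** This is [((1 + a z) / (1 - z)) ^ (1 / (1 + a))], obtained from the equation
    [q g' = g].  At [0] the bound [M = 1] is admissible because
    [|a - 1| + |a| = 1], so the series converges in the whole disc.  At another
    point [z0] let [u] be the local solution and [v] the one for the opposite sign:
    both [u v] and [g v] are constant, so [g = g z0 u] near [z0]. *)
Lemma extremal_factor (a : R) : 0 < a <= 1 / 2 ->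
  exists g : C -> C,
    analytic_on unit_disc g /\ g 0%C = 1%C /\
    forall z, unit_disc z ->
      g z <> 0%C /\ (kernel_cs a z * C_derive g z = g z)%C.
Proof.
intros Ha.
(* Both signs are needed: the product of the two solutions is [1]. *)
assert (Hglob : forall lam, Cmod lam <= 1 -> exists g g' : C -> C, g 0%C = 1%C /\
  forall z, Cmod z < 1 -> cderiv g z (g' z) /\ (kernel_cs a z * g' z = lam * g z)%C).
{ intros lam Hlam.
  destruct (linear_ode_solution 1%C (RtoC (a - 1)) (RtoC (- a)) lam 1) as [c [g [g' [_ [H0 H]]]]].
  - exact C1_nz.
  - lra.
  - rewrite !Cmod_R, Rabs_R1, Rabs_left1, Rabs_left1; lra.
  - rewrite Cmod_1; lra.
  - exists g, g'; split; [exact H0|]; intros z Hz.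
    rewrite Rinv_1 in H; destruct (H z Hz) as [D E]; split; [exact D|].
    rewrite <- E; unfold kernel_cs. rewrite RtoC_minus, RtoC_opp. ring. }
destruct (Hglob 1%C) as [g [g' [Hg0 Hg]]]; [rewrite Cmod_1; lra|].
destruct (Hglob (- (1))%C) as [k [k' [Hk0 Hk]]]; [rewrite Cmod_opp, Cmod_1; lra|].
assert (Hgk : forall z, Cmod z < 1 -> (g z * k z)%C = 1%C).
{ intros z Hz.
  rewrite (opposite_odes_product (kernel_cs a) g g' k k' 1%C 1); auto.
  - rewrite Hg0, Hk0; ring.
  - intros h Hh; now apply kernel_cs_factors_nonzero. }
exists g; split; [|split; [exact Hg0|]].
- intros z0 Hz0.
  set (A := kernel_cs a z0). set (B := (RtoC a - 1 - 2 * RtoC a * z0)%C).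
  set (D := (- RtoC a)%C).
  assert (HA : A <> 0%C) by now apply kernel_cs_factors_nonzero.
  assert (HA0 := proj1 (Cmod_gt_0 A) HA).
  assert (HB0 := Cmod_ge_0 B). assert (HD0 := Cmod_ge_0 D).
  (* Any [M >= 1] with [|A| M >= |B| + |D| + 1] satisfies the hypotheses of
     [linear_ode_solution]. *)
  set (M := 1 + (Cmod B + Cmod D + 1) / Cmod A).
  assert (HM1 : 0 < (Cmod B + Cmod D + 1) / Cmod A) by (apply Rdiv_lt_0_compat; lra).
  assert (HM : Cmod A * M = Cmod A + (Cmod B + Cmod D + 1)) by (unfold M; field; lra).
  assert (HM2 : 1 < M) by (unfold M; lra).
  assert (HMA : Cmod B * M + Cmod D <= Cmod A * M ^ 2).
  { replace (Cmod A * M ^ 2) with (M * (Cmod A * M)) by ring. rewrite HM. nra. }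
  assert (HMl : forall lam, Cmod lam = 1 -> Cmod lam <= Cmod A * M) by (intros; lra).
  destruct (linear_ode_solution A B D 1%C M HA ltac:(lra) HMA (HMl _ Cmod_1))
    as [c [u [u' [Hc [Hu0 Hu]]]]].
  destruct (linear_ode_solution A B D (- (1))%C M HA ltac:(lra) HMA
    (HMl _ ltac:(now rewrite Cmod_opp, Cmod_1))) as [_ [v [v' [_ [Hv0 Hv]]]]].
  set (r := Rmin (/ M) (1 - Cmod z0)).
  assert (Hz0' : Cmod z0 < 1) by exact Hz0.
  assert (Hr : 0 < r) by (apply Rmin_glb_lt; [apply Rinv_0_lt_compat|]; lra).
  assert (Hr1 : forall h, Cmod h < r -> Cmod h < / M)
    by (intros h Hh; eapply Rlt_le_trans; [exact Hh|apply Rmin_l]).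
  assert (Hr2 : forall h, Cmod h < r -> Cmod (z0 + h)%C < 1).
  { intros h Hh; eapply Rle_lt_trans; [apply Cmod_triangle|].
    assert (Cmod h < 1 - Cmod z0) by (eapply Rlt_le_trans; [exact Hh|apply Rmin_r]). lra. }
  assert (Hq : forall h, (A + B * h + D * h ^ 2)%C = kernel_cs a (z0 + h)%C)
    by (intros h; unfold A, B, D, kernel_cs; ring).
  assert (Hqnz : forall h, Cmod h < r -> (A + B * h + D * h ^ 2)%C <> 0%C).
  { intros h Hh; rewrite Hq; apply kernel_cs_factors_nonzero; [exact Ha|now apply Hr2]. }
  assert (Hgv : forall h, Cmod h < r -> (g (z0 + h) * v h)%C = g z0).
  { intros h Hh.
    rewrite (opposite_odes_product (fun h => A + B * h + D * h ^ 2)%C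
      (fun h => g (z0 + h)%C) (fun h => g' (z0 + h)%C) v v' 1%C r); auto.
    - rewrite Hv0, Cplus_0_r; ring.
    - intros x Hx; destruct (Hg _ (Hr2 x Hx)) as [Dg Eg]; split.
      + destruct Dg as [K HK]; exists K; eapply near_imp; [|exact HK].
        intros y Hy; cbv beta in Hy |- *; now rewrite <- Cplus_assoc in Hy.
      + now rewrite Hq. }
  assert (Huv : forall h, Cmod h < r -> (u h * v h)%C = 1%C).
  { intros h Hh.
    rewrite (opposite_odes_product (fun h => A + B * h + D * h ^ 2)%C u u' v v' 1%C r); auto.
    rewrite Hu0, Hv0; ring. }
  apply analytic_at_psum; exists (fun n => (g z0 * c n)%C), r; split; [exact Hr|].
  intros h Hh.
  replace (g (z0 + h)%C) with (g z0 * u h)%C.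
  + eapply csum_ext; [|exact (csum_scal (g z0) _ _ (Hc h (Hr1 h Hh)))].
    intros n; simpl; ring.
  + rewrite <- (Hgv h Hh).
    transitivity (g (z0 + h) * (u h * v h))%C; [ring|]. rewrite (Huv h Hh); ring.
- intros z Hz; split.
  + intros E; apply C1_nz; rewrite <- (Hgk z Hz), E; ring.
  + destruct (Hg z Hz) as [D E]. rewrite (cderiv_C_derive _ _ _ D), E; ring.
Qed.

(** The function [f z = z g z], whose Schwarz function is the identity.  The second
    part is the formula
    [f'' / f' = 1 / q + (1 + a z^2) / (q (q + z))] with the denominators cleared. *)
Lemma extremal_function (a : R) : 0 < a <= 1 / 2 ->
  exists f : C -> C, class_cs a f /\
    forall z, unit_disc z ->
      (pre_schwarzian f z * (kernel_cs a z * (kernel_cs a z + z))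
       = kernel_cs a z + z + (1 + RtoC a * z ^ 2))%C.
Proof.
intros Ha.
destruct (extremal_factor a Ha) as [g [Hg [Hg0 Hgz]]].
set (f := fun z => (z * g z)%C). exists f.
assert (Hf : analytic_on unit_disc f) by (intros z Hz; now apply analytic_at_id_mult, Hg).
assert (Hf' : forall z, unit_disc z -> C_derive f z = (g z + z * C_derive g z)%C).
{ intros z Hz; apply cderiv_C_derive.
  assert (Dg := proj1 (analytic_at_derive g z (Hg z Hz))).
  assert (D := cderiv_mult _ _ _ _ _ (cderiv_id z) Dg). cbv beta in D.
  now rewrite Cmult_1_l in D. }
assert (Hq := fun z Hz => proj2 (proj2 (kernel_cs_factors_nonzero a z Ha Hz))).
assert (Hfq : forall z, unit_disc z ->
  (C_derive f z * kernel_cs a z = g z * (kernel_cs a z + z))%C).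
{ intros z Hz; rewrite (Hf' z Hz).
  transitivity (g z * kernel_cs a z + z * (kernel_cs a z * C_derive g z))%C; [ring|].
  rewrite (proj2 (Hgz z Hz)); ring. }
assert (Hd0 : unit_disc 0%C) by (unfold unit_disc; rewrite Cmod_0; lra).
assert (Hstar : forall z, unit_disc z -> star_quotient f z = phi_cs a z).
{ intros z Hz; unfold star_quotient, phi_cs.
  destruct (Ceq_dec z 0%C) as [->|Hz0].
  - unfold Cdiv; ring.
  - change ((1 - z) * (1 + RtoC a * z))%C with (kernel_cs a z).
    assert (Hgnz := proj1 (Hgz z Hz)). assert (Hqz := Hq z Hz).
    replace (C_derive f z) with (C_derive f z * kernel_cs a z / kernel_cs a z)%C
      by (field; exact Hqz).
    rewrite (Hfq z Hz); unfold f; field; auto. }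
split; [split; [split; [exact Hf|split]|split]|].
- unfold f; ring.
- rewrite (Hf' _ Hd0), Hg0; ring.
- intros z Hz Hz0; apply Cmult_neq_0; [exact Hz0|now apply Hgz].
- split; [|split; [now apply phi_cs_analytic|]].
  + intros z Hz; apply (analytic_at_ext (phi_cs a)); [|now apply phi_cs_analytic].
    eapply near_imp; [|exact (unit_disc_near z Hz)].
    intros h Hh; symmetry; now apply Hstar.
  + exists (fun z => z); split; [intros z _; apply analytic_at_id|].
    split; [auto|split; [reflexivity|exact Hstar]].
- intros z Hz.
  destruct (phi_cs_bounds a z (kernel_cs a z) Ha Hz eq_refl) as [_ [HS _]].
  apply Cmod_gt_0 in HS.
  assert (Hqz := Hq z Hz). destruct (Hgz z Hz) as [Hgnz Eg].
  assert (Dg := proj1 (analytic_at_derive g z (Hg z Hz))).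
  assert (Df1 := proj1 (analytic_at_derive _ z (proj2 (analytic_at_derive f z (Hf z Hz))))).
  assert (Dq := cderiv_mult _ _ _ _ _
    (cderiv_plus _ _ _ _ _ (cderiv_const 1%C z)
       (cderiv_mult _ _ _ _ _ (cderiv_const (-1)%C z) (cderiv_id z)))
    (cderiv_plus _ _ _ _ _ (cderiv_const 1%C z)
       (cderiv_mult _ _ _ _ _ (cderiv_const (RtoC a) z) (cderiv_id z)))).
  apply (cderiv_ext _ (kernel_cs a)) in Dq;
    [|exists 1; split; [lra|]; intros h _; unfold kernel_cs; ring].
  assert (DL := cderiv_mult _ _ _ _ _ Df1 Dq).
  assert (DR := cderiv_mult _ _ _ _ _ Dg (cderiv_plus _ _ _ _ _ Dq (cderiv_id z))).
  apply (cderiv_ext _ (fun x => (g x * (kernel_cs a x + x))%C)) in DL;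
    [|eapply near_imp; [|exact (unit_disc_near z Hz)]; intros h Hh; exact (Hfq _ Hh)].
  assert (U := cderiv_unique _ _ _ _ DL DR). cbv beta in U. clear DL DR Df1 Dg Dq.
  assert (E1 := Hfq z Hz).
  assert (Hqe : kernel_cs a z = ((1 - z) * (1 + RtoC a * z))%C) by reflexivity.
  unfold pre_schwarzian.
  set (q := kernel_cs a z) in *. set (F1 := C_derive f z) in *.
  set (F2 := C_derive (C_derive f) z) in *. set (G := g z) in *.
  set (G1 := C_derive g z) in *.
  assert (HF1 : F1 <> 0%C).
  { intros E; rewrite E in E1.
    apply (Cmult_neq_0 G (q + z)%C Hgnz HS). rewrite <- E1; ring. }
  assert (U1 : (F2 * q + F1 * (RtoC a - 1 - 2 * RtoC a * z)
     = G1 * (q + z) + G * (RtoC a - 2 * RtoC a * z))%C).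
  { transitivity (F2 * q + F1 * (((0 + (0 * z + -1 * 1)) * (1 + RtoC a * z) +
      (1 + -1 * z) * (0 + (0 * z + RtoC a * 1)))))%C; [ring|].
    rewrite U; ring. }
  assert (U2 : (F2 * (q * q) = G * (q + z + (1 + RtoC a * z ^ 2)))%C).
  { transitivity (q * (F2 * q + F1 * (RtoC a - 1 - 2 * RtoC a * z))
      - (F1 * q) * (RtoC a - 1 - 2 * RtoC a * z))%C; [ring|].
    rewrite U1, E1.
    transitivity ((q * G1) * (q + z) + G * (q * (RtoC a - 2 * RtoC a * z)
      - (q + z) * (RtoC a - 1 - 2 * RtoC a * z)))%C; [ring|].
    rewrite Eg, Hqe; ring. }
  replace (F2 / F1 * (q * (q + z)))%C with (F2 * (q * q) * (q + z) / (F1 * q))%C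
    by (field; auto).
  rewrite U2, E1; field; auto.
Qed.

(* The conjunct [C_derive f z <> 0] says that the pre-Schwarzian derivative,
   hence its norm, is well defined on the class. *)
Theorem corollary4p4 (a : R) (ha0 : 0 < a) (ha1 : a <= 1 / 2) :
  (forall f : C -> C, class_cs a f ->
     (forall z : C, unit_disc z -> C_derive f z <> 0%C) /\
     Rbar_le (pre_schwarzian_norm f) (Finite (2 * (2 + a) / (1 + a))))
  /\
  (forall K : R,
     (forall f : C -> C, class_cs a f ->
        Rbar_le (pre_schwarzian_norm f) (Finite K)) ->
     2 * (2 + a) / (1 + a) <= K).
Proof.
assert (Ha : 0 < a <= 1 / 2) by lra.
split.
- intros f Hf; split.
  + intros z Hz; now apply (class_cs_bound a f z Ha Hf Hz).
  + unfold pre_schwarzian_norm.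
    match goal with |- Rbar_le (Lub_Rbar ?E) _ => apply (proj2 (Lub_Rbar_correct E)) end.
    intros x [z [Hz ->]]. now apply (class_cs_bound a f z Ha Hf Hz).
- intros K HK.
  destruct (extremal_function a Ha) as [f [Hf HP]].
  specialize (HK f Hf).
  (* The value of [(1 - x^2) P_f x] is
     [(1 + x) (2 + a x) / ((1 + a x) (1 + a x (1 - x)))]. *)
  assert (Hx : forall x : R, 0 < x < 1 ->
    (1 + x) * (2 + a * x) <= K * ((1 + a * x) * (1 + a * x * (1 - x)))).
  { intros x Hx.
    assert (Hm : Cmod (RtoC x) = x) by (rewrite Cmod_R; apply Rabs_pos_eq; lra).
    assert (Hd : unit_disc (RtoC x)) by (unfold unit_disc; lra).
    assert (Hle : (1 - x ^ 2) * Cmod (pre_schwarzian f (RtoC x)) <= K).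
    { change (Rbar_le ((1 - x ^ 2) * Cmod (pre_schwarzian f (RtoC x))) K).
      apply (Rbar_le_trans _ (pre_schwarzian_norm f) K); [|exact HK].
      unfold pre_schwarzian_norm.
      match goal with |- Rbar_le _ (Lub_Rbar ?E) => apply (proj1 (Lub_Rbar_correct E)) end.
      exists (RtoC x); split; [exact Hd|now rewrite Hm]. }
    assert (E := f_equal Cmod (HP _ Hd)).
    replace (kernel_cs a (RtoC x)) with (RtoC ((1 - x) * (1 + a * x))) in E
      by (unfold kernel_cs; rewrite RtoC_mult, RtoC_minus, RtoC_plus, RtoC_mult; reflexivity).
    rewrite <- RtoC_pow, <- !RtoC_mult, <- !RtoC_plus, <- RtoC_mult in E.
    rewrite Cmod_mult, !Cmod_R in E.
    assert (H1 : 0 < (1 - x) * (1 + a * x)) by (apply Rmult_lt_0_compat; nra).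
    assert (H2 : 0 < (1 - x) * (1 + a * x) + x) by lra.
    rewrite !Rabs_pos_eq in E; [|nra|apply Rmult_le_pos; lra].
    set (P := Cmod (pre_schwarzian f (RtoC x))) in *.
    assert (H3 : 0 < (1 + a * x) * (1 + a * x * (1 - x))).
    { assert (0 < a * x * (1 - x)) by (repeat apply Rmult_lt_0_compat; lra).
      apply Rmult_lt_0_compat; nra. }
    apply (Rmult_le_compat_r ((1 + a * x) * (1 + a * x * (1 - x)))) in Hle; [|lra].
    eapply Rle_trans; [|exact Hle]. right.
    replace ((1 - x ^ 2) * P * ((1 + a * x) * (1 + a * x * (1 - x))))
      with ((1 + x) * (P * ((1 - x) * (1 + a * x) * ((1 - x) * (1 + a * x) + x)))) by ring.
    rewrite E; ring. }
  assert (HK0 : 0 < K).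
  { assert (H := Hx (1 / 2) ltac:(lra)).
    assert (0 < (1 + a * (1 / 2)) * (1 + a * (1 / 2) * (1 - 1 / 2))) by nra. nra. }
  apply Rmult_le_reg_r with (1 + a); [lra|].
  replace (2 * (2 + a) / (1 + a) * (1 + a)) with (2 * (2 + a)) by (field; lra).
  (* Let [x = 1 - t] tend to [1]. *)
  apply (le_of_near_le _ _ (2 + 3 * a + K * (1 + a) * a)).
  eapply near_imp; [|exact (near_small 1 Rlt_0_1)].
  intros h Hh Hh0; cbv beta in Hh; apply Cmod_gt_0 in Hh0. set (t := Cmod h) in *.
  assert (H := Hx (1 - t) ltac:(lra)).
  assert (H1 : (1 + a * (1 - t)) * (1 + a * (1 - t) * (1 - (1 - t))) <= (1 + a) * (1 + a * t)).
  { assert (0 <= a * (1 - t) * t) by (repeat apply Rmult_le_pos; lra).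
    assert (a * (1 - t) * t <= a * t) by nra.
    apply Rmult_le_compat; nra. }
  apply (Rmult_le_compat_l K) in H1; [|lra].
  nra.
Qed.
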